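(* Let $D\subset\mathbb{R}^N$ be a bounded open set, let $p\in\mathcal{P}^{\log}(D)$ with $p_->1$, and let $f_i\in W^{-1,p'(x)}(D)$, $i=1,2$. There exist a constant $C>0$ depending only on $p_-$, $p_+$ and $\max\{\|f_1\|_{-1,p'(x)},\|f_2\|_{-1,p'(x)}\}$, and a constant $\beta>0$ depending only on $p_-$ and $p_+$, such that for every open $\Omega\subset D$, $$\int_D|\nabla u^{f_1}_\Omega-\nabla u^{f_2}_\Omega|^{p(x)}\,dx\le C\left(\|f_1-f_2\|_{-1,p'(x)}+\|f_1-f_2\|_{-1,p'(x)}^{\beta}\right).$$
   Context: For a bounded open set $U\subset\mathbb{R}^N$ and a measurable bounded $p\colon U\to[1,\infty)$, put $p_-=\inf_U p$, $p_+=\sup_U p$. One writes $p\in\mathcal{P}^{\log}(U)$ if in addition $\sup_{x\ne y\in U}\log(|x-y|^{-1})|p(x)-p(y)|<\infty$. $p'(x)=p(x)/(p(x)-1)$. $L^{p(x)}(U)$ is the set of $g\in L^1_{loc}(U)$ with $\rho_{p(x)}(g)=\int_U|g|^{p(x)}dx<\infty$, with norm $\|g\|_{p(x)}=\inf\{\lambda>0:\rho_{p(x)}(g/\lambda)<1\}$. $W^{1,p(x)}(U)$ is the set of $u\in W^{1,1}_{loc}(U)$ with $u,\partial_iu\in L^{p(x)}(U)$ for $i=1,\dots,N$, normed by $\|u\|_{p(x)}+\|\nabla u\|_{p(x)}$ (or an equivalent norm). $W^{1,p(x)}_0(U)$ is the closure in $W^{1,p(x)}(U)$ of the functions with compact support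 in $U$, normed by $\|\nabla u\|_{p(x)}$. $W^{-1,p'(x)}(U)$ is its topological dual, with pairing $\langle\cdot,\cdot\rangle$ and norm $\|f\|_{-1,p'(x)}=\sup\{\langle f,u\rangle:u\in W^{1,p(x)}_0(U),\ \|\nabla u\|_{p(x)}\le1\}$; in the claim the norm is that of $W^{-1,p'(x)}(D)$. If $\Omega\subset D$ is open, $W_0^{1,p(x)}(\Omega)\subset W_0^{1,p(x)}(D)$ via extension by zero, and elements of $W^{-1,p'(x)}(D)$ act on $W^{1,p(x)}_0(\Omega)$ by restriction. $u^f_\Omega$ is the unique weak solution of the Dirichlet problem $-\Delta_{p(x)}u=f$ in $\Omega$, $u=0$ on $\partial\Omega$, i.e. the unique $u\in W^{1,p(x)}_0(\Omega)$ with $\int_\Omega|\nabla u|^{p(x)-2}\nabla u\cdot\nabla v\,dx=\langle f,v\rangle$ for all $v\in W^{1,p(x)}_0(\Omega)$. *)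

(* Defs.v *)
From HB Require Import structures.
From mathcomp Require Import all_boot all_order all_algebra.
From mathcomp Require Import all_classical all_reals all_analysis.

Set Implicit Arguments.
Unset Strict Implicit.
Unset Printing Implicit Defensive.

Import Order.TTheory GRing.Theory Num.Theory.
Import numFieldNormedType.Exports.

Local Open Scope classical_set_scope.
Local Open Scope ring_scope.

(* The topology of ['rV[R]_N] is the library's one (sup norm); since all norms
   of R^N are equivalent, openness, compactness, boundedness and continuity are
   the usual ones.  Wherever the value of a norm matters, [enorm] is used. *)
Section Euclidean.
Context {R : realType} {N : nat}.
Implicit Types x y : 'rV[R]_N.

Definition dotp x y : R := \sum_(i < N) x 0 i * y 0 i.

Definition enorm x : R := Num.sqrt (dotp x x).

End Euclidean.

Definition rV_display : measure_display -> measure_display.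
Proof. exact. Qed.

Section BorelSets.
Context {R : realType} {N : nat}.

Definition rV_coord (i : 'I_N) (x : 'rV[R]_N) : measurableTypeR R := x 0 i.

Let rV_set0 : g_sigma_preimage rV_coord set0.
Proof. exact: sigma_algebra0. Qed.

Let rV_setC A : g_sigma_preimage rV_coord A -> g_sigma_preimage rV_coord (~` A).
Proof. exact: sigma_algebraC. Qed.

Let rV_bigcup (F : (set 'rV[R]_N)^nat) :
  (forall i, g_sigma_preimage rV_coord (F i)) ->
  g_sigma_preimage rV_coord (\bigcup_i F i).
Proof. exact: sigma_algebra_bigcup. Qed.

(* The sigma-algebra generated by the coordinates, i.e. the Borel one. *)
HB.instance Definition _ := @isMeasurable.Build (rV_display default_measure_display)
  'rV[R]_N (g_sigma_preimage rV_coord) rV_set0 rV_setC rV_bigcup.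

Lemma measurable_rV_coord (i : 'I_N) : measurable_fun setT (rV_coord i).
Proof.
move=> _ Y mY; rewrite setTI; apply: sub_sigma_algebra => /=.
rewrite -bigcup_seq/=; exists i => /=; first by rewrite mem_index_enum.
by exists Y => //; rewrite setTI.
Qed.

Lemma measurable_fun_rVP d (T : measurableType d) (f : T -> 'rV[R]_N) :
  (forall i, measurable_fun setT (rV_coord i \o f)) -> measurable_fun setT f.
Proof.
move=> mf _ A mA; rewrite setTI.
have sT : sigma_algebra setT [set B : set 'rV[R]_N | measurable (f @^-1` B)].
  split => /=; first by rewrite preimage_set0.
  - by move=> B mB; rewrite setTD preimage_setC; exact: measurableC.
  - by move=> F mF; rewrite preimage_bigcup; exact: bigcupT_measurable.
apply: (@smallest_sub _ _ _ _ sT _ A mA) => B; rewrite -bigcup_seq/= => -[i _].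
by move=> [C mC <-]; rewrite /= setTI -comp_preimage -[X in measurable X]setTI;
  exact: mf.
Qed.

End BorelSets.

Section LebesgueMeasure.
Context {R : realType}.

Definition rV_cons n (z : 'rV[R]_n * measurableTypeR R) : 'rV[R]_n.+1 :=
  row_mx (z.2%:M : 'rV[R]_1) z.1.

Lemma measurable_rV_cons n : measurable_fun setT (@rV_cons n).
Proof.
apply: measurable_fun_rVP => i; case: (@splitP 1 n i) => j ij.
- rewrite (_ : _ \o _ = snd); first exact: measurable_snd.
  apply/funext => z; rewrite /= /rV_coord /rV_cons.
  have -> : i = lshift n j by apply/val_inj.
  by rewrite (@row_mxEl _ 1 1 n) !ord1 mxE eqxx mulr1n.
- rewrite (_ : _ \o _ = rV_coord j \o fst).
    apply: measurableT_comp; first exact: measurable_rV_coord.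
    exact: measurable_fst.
  apply/funext => z; rewrite /= /rV_coord /rV_cons.
  have -> : i = rshift 1 j by apply/val_inj.
  by rewrite (@row_mxEr _ 1 1 n).
Qed.

Section step.
Variables (n : nat) (m : {measure set 'rV[R]_n -> \bar R}).

Definition lebesgue_rV_step : set 'rV[R]_n.+1 -> \bar R :=
  pushforward (m \x @lebesgue_measure R)%E (@rV_cons n).

Let step0 : lebesgue_rV_step set0 = 0%E.
Proof. by rewrite /lebesgue_rV_step /pushforward preimage_set0 measure0. Qed.

Let step_ge0 A : (0 <= lebesgue_rV_step A)%E.
Proof. by rewrite /lebesgue_rV_step /pushforward measure_ge0. Qed.

Let step_sigma_additive : semi_sigma_additive lebesgue_rV_step.
Proof.
have mf := @measurable_rV_cons n.
exact: (@measure_semi_sigma_additive _ _ _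
  (measure_function_pushforward__canonical__measure_function_Measure _ mf)).
Qed.

HB.instance Definition _ := isMeasure.Build _ _ _ lebesgue_rV_step
  step0 step_ge0 step_sigma_additive.

End step.

(* The N-fold product of the Lebesgue measure of R. *)
Fixpoint lebesgue_rV n : {measure set 'rV[R]_n -> \bar R} :=
  if n is n'.+1 then lebesgue_rV_step (lebesgue_rV n')
  else \d_ (0 : 'rV[R]_0).

End LebesgueMeasure.

Section VariableExponentSpaces.
Context {R : realType} {N : nat}.
Local Notation mu := (@lebesgue_rV R N).
Implicit Types (U : set 'rV[R]_N) (p g u v phi : 'rV[R]_N -> R).
Implicit Types (G : 'rV[R]_N -> 'rV[R]_N).

Definition variable_exponent U p : Prop :=
  [/\ measurable_fun U p, forall x, U x -> 1 <= p x &
      exists M : R, forall x, U x -> p x <= M].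

Definition p_minus U p : R := inf [set p x | x in U].

Definition p_plus U p : R := sup [set p x | x in U].

Definition log_exponent U p : Prop :=
  variable_exponent U p /\
  exists K : R, forall x y, U x -> U y -> x != y ->
    ln (enorm (x - y))^-1 * `|p x - p y| <= K.

Definition L1loc U g : Prop :=
  measurable_fun U g /\
  forall K, compact K -> K `<=` U -> (\int[mu]_(x in K) `|g x|%:E < +oo)%E.

Definition modular U p g : \bar R := (\int[mu]_(x in U) (`|g x| `^ p x)%:E)%E.

Definition Lp U p g : Prop := L1loc U g /\ (modular U p g < +oo)%E.

Definition Lp_norm U p g : R :=
  inf [set l : R | 0 < l /\ (modular U p (fun x => g x / l)%R < 1)%E].

Definition partial (i : 'I_N) phi : 'rV[R]_N -> R :=
  'D_(delta_mx 0 i : 'rV[R]_N) phi.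

Fixpoint Ck (k : nat) phi : Prop :=
  continuous phi /\
  (if k is k'.+1 then
     forall i : 'I_N,
       (forall x, derivable phi x (delta_mx 0 i : 'rV[R]_N)) /\
       Ck k' (partial i phi)
   else True).

Definition supported_in U v : Prop :=
  exists K, [/\ compact K, K `<=` U & forall x, U x -> ~ K x -> v x = 0].

(* [phi] is defined on the whole space, so it has to vanish outside [U] too. *)
Definition test_function U phi : Prop :=
  [/\ forall k, Ck k phi, supported_in U phi & forall x, ~ U x -> phi x = 0].

Definition weak_gradient U u G : Prop :=
  [/\ L1loc U u, forall i, L1loc U (fun x => G x 0 i) &
      forall phi (i : 'I_N), test_function U phi ->
        \int[mu]_(x in U) (u x * partial i phi x) =
        - \int[mu]_(x in U) (G x 0 i * phi x)].

(* The weak gradient is unique up to a null set of [U]; [grad] picks a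
   representative (and is the zero field when there is no weak gradient). *)
Definition grad U u : 'rV[R]_N -> 'rV[R]_N :=
  xget (fun=> 0) [set G | weak_gradient U u G].

Definition W1p U p u : Prop :=
  [/\ exists G, weak_gradient U u G, Lp U p u &
      forall i, Lp U p (fun x => grad U u x 0 i)].

Definition grad_norm U p u : R := Lp_norm U p (fun x => enorm (grad U u x)).

Definition W1p_norm U p u : R := Lp_norm U p u + grad_norm U p u.

Definition W1p0 U p u : Prop :=
  W1p U p u /\
  forall e : R, 0 < e ->
    exists v, [/\ W1p U p v, supported_in U v & W1p_norm U p (u \- v) < e].

(* Functionals act on representatives; the bound makes them compatible with
   equality almost everywhere on [U]. *)
Definition W1p0_dual U p (f : ('rV[R]_N -> R) -> R) : Prop :=
  (forall (a b : R) u v, W1p0 U p u -> W1p0 U p v ->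
     f (fun x => a * u x + b * v x) = a * f u + b * f v) /\
  (exists c : R, forall u, W1p0 U p u -> `|f u| <= c * grad_norm U p u).

Definition dual_norm U p (f : ('rV[R]_N -> R) -> R) : R :=
  sup [set f u | u in [set u | W1p0 U p u /\ grad_norm U p u <= 1]].

Definition extend0 U u : 'rV[R]_N -> R := patch (fun=> 0) U u.

(* Where the gradient vanishes the integrand is 0, also if p(x) < 2: the scalar
   product is 0 and [powR] is total. *)
Definition weak_solution U p (f : ('rV[R]_N -> R) -> R) u : Prop :=
  W1p0 U p u /\
  forall v, W1p0 U p v ->
    \int[mu]_(x in U)
      (enorm (grad U u x) `^ (p x - 2) * dotp (grad U u x) (grad U v x)) =
    f (extend0 U v).

End VariableExponentSpaces.

(* Main.v *)
Require Import Defs.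
From HB Require Import structures.
From mathcomp Require Import all_boot all_order all_algebra.
From mathcomp Require Import all_classical all_reals all_analysis measurable_realfun.
From mathcomp Require Import ring lra.

Set Implicit Arguments.
Unset Strict Implicit.
Unset Printing Implicit Defensive.
Import Order.TTheory GRing.Theory Num.Theory.
Import numFieldNormedType.Exports.

Local Open Scope classical_set_scope.
Local Open Scope ring_scope.

(** Testing the two weak formulations with u1 - u2 and subtracting gives

      int_Omega (F u1 - F u2) . (grad u1 - grad u2) = <f1 - f2, u1 - u2>,
      F u = |grad u|^(p-2) grad u,

    so that everything rests on comparing the integrand on the left with
    |grad u1 - grad u2|^p, and on bounding the norm of u1 - u2 on the right.

    For the comparison ([enormB_powR_le_gap]) the field a |-> |a|^(p-2) a is
    strongly monotone with a constant that only depends on p_- > 1, but with the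
    degenerate weight max(|a|,|b|)^(p-2).  Where |a - b| is at least
    s max(|a|,|b|), s in ]0, 1], the weight costs a factor 1/s; elsewhere
    |a - b|^p <= s (|a|^p + |b|^p).  Hence in all cases

      |a - b|^p <= (C/s) (monotonicity gap) + s (|a|^p + |b|^p).

    This replaces Holder's inequality with the variable exponents 2/p and
    2/(2-p), and treats p < 2 and p >= 2 alike.  Testing with u_i itself bounds
    the modular and the norm of grad u_i by p_- and the norms of the data
    ([a_priori_bound]).  After integration ([stability_estimate]), with
    d = |f1 - f2|_{-1,p'},

      int |grad u1 - grad u2|^p <= (A/s) d + s B    for all s in ]0, 1],

    and the choice s = min(1, sqrt d) ([optimize_scale]) gives the theorem with
    exponent 1/2.

    The functionals live on D and the solutions on Omega, so this needs that the
    extension by zero maps W1p0 of Omega into W1p0 of D and extends the gradient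
    by zero ([weak_gradient_extend0], [W1p0_extend0]).  For functions with
    compact support in Omega a smooth cutoff ([smooth_cutoff]) turns a test
    function of D into one of Omega; the general case follows by density.
    Gradients are determined almost everywhere by the fundamental lemma of the
    calculus of variations ([du_bois_reymond]): products of functions
    exp(-1/(n t)) approximate indicators of boxes, and boxes determine an
    integrable function by Dynkin's theorem ([ae_eq0_obox]).

    Luxemburg norms are infima; they are handled through the set [admissible] of
    the scales over which the infimum is taken, for which a triangle inequality
    up to a constant ([admissible_lin]) is enough. *)

(** * The Euclidean norm *)
Section Vectors.
Context {R : realType} {N : nat}.
Implicit Types a b c : 'rV[R]_N.

Lemma dotpC a b : dotp a b = dotp b a.
Proof. by apply: eq_bigr => i _; rewrite mulrC. Qed.

Lemma dotpDl a b c : dotp (a + b) c = dotp a c + dotp b c.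
Proof. by rewrite -big_split; apply: eq_bigr => i _; rewrite !mxE mulrDl. Qed.

Lemma dotpZl (k : R) a b : dotp (k *: a) b = k * dotp a b.
Proof. by rewrite mulr_sumr; apply: eq_bigr => i _; rewrite !mxE mulrA. Qed.

Lemma dotpBl a b c : dotp (a - b) c = dotp a c - dotp b c.
Proof. by rewrite dotpDl -scaleN1r dotpZl mulN1r. Qed.

Lemma dotpBr a b c : dotp c (a - b) = dotp c a - dotp c b.
Proof. by rewrite !(dotpC c) dotpBl. Qed.

Lemma dotp_ge0 a : 0 <= dotp a a.
Proof. by apply: sumr_ge0 => i _; rewrite -expr2 sqr_ge0. Qed.

Lemma enorm_ge0 a : 0 <= enorm a.
Proof. exact: sqrtr_ge0. Qed.

Lemma sqr_enorm a : enorm a ^+ 2 = dotp a a.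
Proof. by rewrite sqr_sqrtr// dotp_ge0. Qed.

Lemma enorm0 : enorm (0 : 'rV[R]_N) = 0.
Proof. by rewrite /enorm /dotp big1 ?sqrtr0// => i _; rewrite mxE mul0r. Qed.

Lemma enormZ (k : R) a : enorm (k *: a) = `|k| * enorm a.
Proof.
by rewrite /enorm dotpZl dotpC dotpZl mulrA -expr2 sqrtrM ?sqr_ge0// sqrtr_sqr.
Qed.

Lemma sqr_enormB a b :
  enorm (a - b) ^+ 2 = enorm a ^+ 2 + enorm b ^+ 2 - 2 * dotp a b.
Proof. by rewrite !sqr_enorm dotpBl !dotpBr (dotpC b a); ring. Qed.

Lemma enorm_eq0 a : enorm a = 0 -> a = 0.
Proof.
move=> /eqP; rewrite sqrtr_eq0 => a0.
have /psumr_eq0P a00 : \sum_(i < N) a 0 i * a 0 i = 0.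
  by apply/le_anti; rewrite a0 dotp_ge0.
apply/rowP => i; rewrite mxE.
have /eqP := a00 (fun i _ => sqr_ge0 (a 0 i)) i isT.
by rewrite mulf_eq0 orbb => /eqP.
Qed.

Lemma dotp_le a b : dotp a b <= enorm a * enorm b.
Proof.
have [/enorm_eq0 ->|bn0] := eqVneq (enorm b) 0.
  by rewrite enorm0 mulr0 -(subrr a) dotpBr subrr.
have [/enorm_eq0 ->|an0] := eqVneq (enorm a) 0.
  by rewrite enorm0 mul0r -(subrr b) dotpBl subrr.
have a0 : 0 < enorm a by rewrite lt_neqAle eq_sym an0 enorm_ge0.
have b0 : 0 < enorm b by rewrite lt_neqAle eq_sym bn0 enorm_ge0.
have := sqr_ge0 (enorm (enorm b *: a - enorm a *: b)).
rewrite sqr_enormB !enormZ !ger0_norm ?enorm_ge0// dotpZl dotpC dotpZl (dotpC b).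
move=> h; have : 0 <= (enorm a * enorm b) * (enorm a * enorm b - dotp a b) by lra.
by rewrite pmulr_rge0 ?mulr_gt0// subr_ge0.
Qed.

Lemma dotp_norm_le a b : `|dotp a b| <= enorm a * enorm b.
Proof.
rewrite ler_norml dotp_le andbT lerNl -mulN1r -dotpZl.
by rewrite (le_trans (dotp_le _ _))// enormZ normrN1 mul1r.
Qed.

Lemma sqr_enormB_ge a b : (enorm a - enorm b) ^+ 2 <= enorm (a - b) ^+ 2.
Proof. by rewrite sqr_enormB; have := dotp_le a b; lra. Qed.

Lemma enorm_triangle a b : enorm (a - b) <= enorm a + enorm b.
Proof.
rewrite -ler_sqr ?nnegrE ?addr_ge0 ?enorm_ge0// sqr_enormB.
by have := dotp_norm_le a b; rewrite ler_norml => /andP[]; lra.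
Qed.

Lemma abs_coord_le_enorm a (i : 'I_N) : `|a 0 i| <= enorm a.
Proof.
rewrite -sqrtr_sqr ler_wsqrtr// /dotp (bigD1 i)//= -expr2 lerDl.
by apply: sumr_ge0 => j _; rewrite -expr2 sqr_ge0.
Qed.

Lemma enorm_le_sum a : enorm a <= \sum_(i < N) `|a 0 i|.
Proof.
have s0 : 0 <= \sum_(i < N) `|a 0 i| by exact: sumr_ge0.
rewrite -ler_sqr ?nnegrE ?enorm_ge0// sqr_enorm expr2 mulr_suml.
apply: ler_sum => i _; apply: (le_trans (ler_norm _)); rewrite normrM.
by rewrite ler_wpM2l// (bigD1 i)//= lerDl sumr_ge0.
Qed.

End Vectors.

(** * Pointwise monotonicity of the p-Laplacian field *)
Section Pointwise.
Context {R : realType}.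

(** For r <= 1 the graph of x ^ r lies below its tangent at 1, by convexity of
    the exponential. *)
Lemma bernoulli_powR (x r : R) : 0 <= x -> 0 < r <= 1 ->
  x `^ r <= 1 + r * (x - 1).
Proof.
move=> x0 /andP[r0 r1].
have [->|xn0] := eqVneq x 0; first by rewrite powR0 ?gt_eqF//; lra.
have xp : 0 < x by rewrite lt_neqAle eq_sym xn0.
have t01 : 0 <= r <= 1 by rewrite (ltW r0).
have := @convex_expR R (Itv01 (ltW r0) r1) (ln x) 0.
rewrite !convRE/= expR0 lnK ?posrE// mulr0 addr0 mulr1.
by rewrite /powR (negbTE xn0) /unstable.onem; lra.
Qed.

(** The one-dimensional case of strong monotonicity, for t |-> t ^ (q + 1) with
    q = p - 2.  For q >= 0 one may replace y ^ q by x ^ q; for q < 0 the function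
    is concave and lies below its tangent at x. *)
Lemma powR_increment (q x y : R) : - 1 < q -> 0 <= y <= x -> 0 < x ->
  Num.min 1 (q + 1) * x `^ q * (x - y) <= x `^ q * x - y `^ q * y.
Proof.
move=> q1 /andP[y0 yx] x0.
have xq0 : 0 < x `^ q by rewrite powR_gt0.
have [q0|q0] := leP 0 q.
  have h : y `^ q <= x `^ q by rewrite ge0_ler_powR// nnegrE// ltW.
  have m1 : Num.min 1 (q + 1) <= 1 by rewrite ge_min lexx.
  have h1 : Num.min 1 (q + 1) * x `^ q * (x - y) <= x `^ q * (x - y).
    by rewrite ler_wpM2r ?subr_ge0// ler_piMl// ltW.
  by rewrite (le_trans h1)// mulrBr lerD2l lerN2 ler_wpM2r.
have -> : Num.min 1 (q + 1) = q + 1 by apply/min_idPr; lra.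
have [->|yn0] := eqVneq y 0.
  by rewrite mulr0 !subr0 -mulrA ler_piMl ?mulr_ge0 1?ltW//; lra.
have yp : 0 < y by rewrite lt_neqAle eq_sym yn0.
have yxq : y `^ q * y = x `^ q * x * (y / x) `^ (q + 1).
  have E z : 0 <= z -> z `^ q * z = z `^ (q + 1).
    by move=> z0; rewrite mulrC -(@mulr_powRB1 _ z (q + 1)) ?addrK//; lra.
  rewrite !E ?(ltW x0)// -powRM ?(ltW x0)// ?divr_ge0 ?(ltW x0)//.
  by rewrite mulrCA divff ?gt_eqF// mulr1.
have r01 : 0 < q + 1 <= 1 by lra.
have yx0 : 0 <= y / x by rewrite divr_ge0 // ltW.
have := bernoulli_powR yx0 r01.
rewrite yxq => h.
have : x `^ q * x * (y / x) `^ (q + 1) <= x `^ q * x * (1 + (q + 1) * (y / x - 1)).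
  by rewrite ler_wpM2l// mulr_ge0 // ltW.
have -> : x `^ q * x * (1 + (q + 1) * (y / x - 1)) =
    x `^ q * x - (q + 1) * x `^ q * (x - y).
  by field; rewrite gt_eqF.
lra.
Qed.

Context {N : nat}.
Implicit Types a b : 'rV[R]_N.

(** The scalar product of |a|^(p-2) a - |b|^(p-2) b with a - b, expanded. *)
Definition monotonicity_gap (p : R) a b : R :=
  enorm a `^ (p - 2) * (dotp a a - dotp a b)
  - enorm b `^ (p - 2) * (dotp b a - dotp b b).

Lemma monotonicity_gapC p a b : monotonicity_gap p a b = monotonicity_gap p b a.
Proof. by rewrite /monotonicity_gap; ring. Qed.

(** Strong monotonicity.  With x = |a|, y = |b|, X = x^(p-2), Y = y^(p-2) the gap
    is (X x - Y y) (x - y) + (X + Y) / 2 (|a - b|^2 - (x - y)^2): the first term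
    is the one-dimensional case, and the second one is nonnegative. *)
Lemma monotonicity_gap_ge p a b : 1 < p -> enorm b <= enorm a -> 0 < enorm a ->
  Num.min 1 (p - 1) / 2 * (enorm a `^ (p - 2) * enorm (a - b) ^+ 2)
  <= monotonicity_gap p a b.
Proof.
move=> p1 ba a0.
have q1 : - 1 < p - 2 by lra.
have := powR_increment q1; rewrite (_ : p - 2 + 1 = p - 1); last by ring.
have ba' : 0 <= enorm b <= enorm a by rewrite enorm_ge0.
move=> /(_ _ _ ba' a0); have := sqr_enormB_ge a b; have := sqr_enormB a b.
rewrite /monotonicity_gap -!sqr_enorm (dotpC b a).
have m1 : Num.min 1 (p - 1) <= 1 by rewrite ge_min lexx.
have m0 : 0 < Num.min 1 (p - 1) by rewrite lt_min ltr01; lra.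
move: (enorm a) (enorm b) (dotp a b) (enorm (a - b)) (Num.min _ _) ba a0 m1 m0.
move=> x y z d m yx x0 m1 m0.
have := powR_ge0 x (p - 2); have := powR_ge0 y (p - 2).
move: (x `^ (p - 2)) (y `^ (p - 2)) => X Y Y0 X0 dE d2 h.
have {}h : m * X * (x - y) * (x - y) <= (X * x - Y * y) * (x - y).
  by rewrite ler_wpM2r// subr_ge0.
have -> : X * (x ^+ 2 - z) - Y * (z - y ^+ 2) =
    (X * x - Y * y) * (x - y) + (X + Y) / 2 * (d ^+ 2 - (x - y) ^+ 2).
  by rewrite dE; field.
have h2 : 0 <= d ^+ 2 - (x - y) ^+ 2 by rewrite subr_ge0.
have h3 : m * X / 2 * (d ^+ 2 - (x - y) ^+ 2) <=
          (X + Y) / 2 * (d ^+ 2 - (x - y) ^+ 2).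
  apply: ler_wpM2r => //; apply: ler_wpM2r; first by rewrite invr_ge0.
  apply: (@le_trans _ _ X); last by rewrite lerDl.
  by rewrite ler_piMl.
have h4 : 0 <= m * X * (x - y) * (x - y).
  by rewrite -mulrA -expr2; apply: mulr_ge0; rewrite ?sqr_ge0// mulr_ge0// ltW.
lra.
Qed.

(** The scale s separates the pairs for which |a - b| is comparable to the larger
    norm, where the degenerate weight of the monotonicity is harmless, from those
    for which |a - b|^p is a small part of |a|^p + |b|^p. *)
Lemma enormB_powR_le_gap pm pp p s a b : 1 < pm -> pm <= p -> p <= pp ->
  0 < s <= 1 ->
  enorm (a - b) `^ p <=
    2 `^ pp * (2 / Num.min 1 (pm - 1)) / s * monotonicity_gap p a b
    + s * (enorm a `^ p + enorm b `^ p).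
Proof.
move=> pm1 pmp ppp /andP[s0 s1].
wlog ba : a b / enorm b <= enorm a.
  move=> h; have [|/ltW] := leP (enorm b) (enorm a); first exact: h.
  move=> /h; rewrite monotonicity_gapC (addrC (_ `^ _) (_ `^ _)).
  by rewrite -(opprB a) -scaleN1r enormZ normrN1 mul1r.
have p0 : 0 < p by lra.
have [a00|an0] := eqVneq (enorm a) 0.
  have b00 : enorm b = 0 by apply/le_anti; rewrite enorm_ge0 -a00 ba.
  rewrite /monotonicity_gap (enorm_eq0 a00) (enorm_eq0 b00) !subrr enorm0.
  by rewrite !powR0 ?gt_eqF// !(mulr0, addr0).
have a0 : 0 < enorm a by rewrite lt_neqAle eq_sym an0 enorm_ge0.
have p1 : 1 < p by lra.
have [a0' s0' p0'] := And3 (ltW a0) (ltW s0) (ltW p0).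
have gap := monotonicity_gap_ge p1 ba a0.
set d := enorm (a - b) in gap *.
have d0 : 0 <= d by exact: enorm_ge0.
have d2a : d <= 2 * enorm a by have := enorm_triangle a b; rewrite -/d; lra.
set m := Num.min 1 (pm - 1).
have m0 : 0 < m by rewrite /m lt_min ltr01; lra.
have mle : m <= Num.min 1 (p - 1).
  by rewrite le_min /m; rewrite !ge_min lexx /= ; apply/orP; right; lra.
set X := enorm a `^ (p - 2) * d ^+ 2 in gap.
have X0 : 0 <= X by rewrite mulr_ge0 ?powR_ge0 ?sqr_ge0.
have XE : X <= 2 / m * monotonicity_gap p a b.
  rewrite -ler_pdivrMl ?divr_gt0// invf_div; apply: le_trans gap.
  by rewrite ler_wpM2r// ler_wpM2r// invr_ge0.
have XE' : 2 `^ pp / s * X <= 2 `^ pp * (2 / m) / s * monotonicity_gap p a b.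
  have -> : 2 `^ pp * (2 / m) / s * monotonicity_gap p a b =
      2 `^ pp / s * (2 / m * monotonicity_gap p a b) by ring.
  by apply: ler_wpM2l => //; rewrite divr_ge0 // powR_ge0.
have ks0 : 0 <= 2 `^ pp / s * X by rewrite mulr_ge0// divr_ge0// powR_ge0.
have k1 : (1 : R) <= 2 `^ pp by rewrite -[leLHS](powRr0 2); apply: ler_powR; lra.
have [sd|ds] := leP (s * enorm a) d; last first.
  apply: (@le_trans _ _ (s * enorm a `^ p)).
    apply: (@le_trans _ _ ((s * enorm a) `^ p)).
      by rewrite ge0_ler_powR ?nnegrE ?mulr_ge0// ltW.
    rewrite powRM// ler_wpM2r ?powR_ge0//.
    by rewrite ge1r_powR ?s0// ltW.
  rewrite ler_wpDl//; first exact: le_trans XE'.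
  by rewrite ler_wpM2l// lerDl powR_ge0.
rewrite ler_wpDr ?mulr_ge0 ?addr_ge0 ?powR_ge0//; apply: le_trans XE'.
have dp : 0 < d by apply: lt_le_trans sd; rewrite mulr_gt0.
have -> : d `^ p = d `^ (p - 2) * d ^+ 2.
  by rewrite -powR_mulrn// -powRD ?(gt_eqF dp) ?implybT// subrK.
rewrite /X mulrA ler_wpM2r ?sqr_ge0//.
have [q0|q0] := leP 0 (p - 2).
  apply: (@le_trans _ _ ((2 * enorm a) `^ (p - 2))).
    by rewrite ge0_ler_powR ?nnegrE// mulr_ge0.
  rewrite powRM ?(ltW a0)// ler_wpM2r ?powR_ge0//.
  apply: (@le_trans _ _ (2 `^ pp)); first by apply: ler_powR; lra.
  by rewrite ler_pMr ?powR_gt0// invf_ge1.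
have [r0 r1] : 0 < 2 - p /\ 2 - p < 1 by lra.
rewrite (_ : p - 2 = - (2 - p)); last by ring.
apply: (@le_trans _ _ ((s * enorm a) `^ (- (2 - p)))).
  rewrite !powRN lef_pV2 ?posrE ?powR_gt0 ?mulr_gt0//.
  by rewrite ge0_ler_powR ?nnegrE ?mulr_ge0// ltW.
rewrite powRM ?(ltW s0) ?(ltW a0)// ler_wpM2r ?powR_ge0//.
apply: (@le_trans _ _ s^-1).
  rewrite powRN lef_pV2 ?posrE ?powR_gt0//.
  by rewrite ger1_powR ?s0// ltW.
by rewrite ler_pMl ?invr_gt0.
Qed.

End Pointwise.

(** * Boxes and Borel sets *)
Section Boxes.
Context {R : realType} {N : nat}.
Implicit Types (a b x y : 'rV[R]_N) (U K : set 'rV[R]_N).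
Local Notation mu := (@lebesgue_rV R N).

Definition obox a b : set 'rV[R]_N := [set y | forall i, a 0 i < y 0 i < b 0 i].

Definition cbox a b : set 'rV[R]_N := [set y | forall i, a 0 i <= y 0 i <= b 0 i].

Lemma obox_cbox a b : obox a b `<=` cbox a b.
Proof. by move=> y aby i; have /andP[/ltW -> /ltW ->] := aby i. Qed.

Lemma compact_cbox a b : compact (cbox a b).
Proof.
have -> : cbox a b = [set v : 'rV[R]_N | forall i, `[a 0 i, b 0 i]%classic (v ord0 i)].
  by apply/seteqP; split=> y h i; have := h i; rewrite /= in_itv.
apply: (@rV_compact R N (fun i => `[a 0 i, b 0 i]%classic)) => i.
exact: segment_compact.
Qed.

Lemma measurable_box (I : 'I_N -> interval R) :
  measurable [set y : 'rV[R]_N | forall i, y 0 i \in I i].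
Proof.
rewrite (_ : [set _ | _] =
    \big[setI/setT]_(i < N) (rV_coord i @^-1` [set` I i] : set 'rV[R]_N)).
  apply: bigsetI_measurable => i _; rewrite -[X in measurable X]setTI.
  exact: measurable_rV_coord.
rewrite -bigcap_seq; apply/seteqP; split=> [y h i _ /=|y h i].
  exact: h.
by apply: (h i); rewrite /= mem_index_enum.
Qed.

Lemma measurable_obox a b : measurable (obox a b).
Proof.
rewrite (_ : obox a b = [set y : 'rV[R]_N | forall i, y 0 i \in `]a 0 i, b 0 i[]).
  exact: measurable_box.
by apply/seteqP; split=> y h i; have := h i; rewrite /= in_itv.
Qed.

Lemma measurable_cbox a b : measurable (cbox a b).
Proof.
rewrite (_ : cbox a b = [set y : 'rV[R]_N | forall i, y 0 i \in `[a 0 i, b 0 i]]).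
  exact: measurable_box.
by apply/seteqP; split=> y h i; have := h i; rewrite /= in_itv.
Qed.

Lemma open_box_sub U x : open U -> U x ->
  exists2 e, 0 < e & forall y, (forall i, `|x 0 i - y 0 i| < e) -> U y.
Proof.
rewrite openE => Uo /Uo; rewrite /interior => /nbhs_ballP[e /= e0 eU].
exists e => // y xy; apply: eU; split => // i j.
by rewrite (ord1 i); exact: xy.
Qed.

(** The boxes are cubes with rational centres and radii 1/(k+1).  The inclusion
    of the closed boxes makes integrability on them, and test functions supported
    in them, available. *)
Lemma open_box_cover U : (0 < N)%N -> open U ->
  exists a b : nat -> 'rV[R]_N, U = \bigcup_n obox (a n) (b n) /\
    forall n, cbox (a n) (b n) `<=` U.
Proof.
move=> N0 Uo.
pose lo (z : 'rV[rat]_N * nat) : 'rV[R]_N := \row_i (ratr (z.1 0 i) - z.2.+1%:R^-1).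
pose hi (z : 'rV[rat]_N * nat) : 'rV[R]_N := \row_i (ratr (z.1 0 i) + z.2.+1%:R^-1).
pose good z := cbox (lo z) (hi z) `<=` U.
pose F n := if unpickle n is Some z then
    if pselect (good z) then (lo z, hi z) else (const_mx 1, const_mx 0)
  else (const_mx 1, const_mx 0) : 'rV[R]_N * 'rV[R]_N.
(* Indices that do not encode a cube inside U are sent to an empty box. *)
have FU n : cbox (F n).1 (F n).2 `<=` U.
  have c10 : cbox (const_mx 1) (const_mx 0) `<=` U.
    move=> y /(_ (Ordinal N0)); rewrite !mxE => /andP[h1 h2].
    by have := le_trans h1 h2; rewrite ler10.
  by rewrite /F; case: (unpickle n) => // z; case: pselect.
exists (fun n => (F n).1), (fun n => (F n).2); split => //.
apply/seteqP; split => [x Ux|x [n _ /obox_cbox]]; last exact: FU.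
have [e e0 eU] := open_box_sub Uo Ux.
have [k ke] : exists k : nat, k.+1%:R^-1 < e / 2.
  have := near_infty_natSinv_lt (PosNum (divr_gt0 e0 (ltr0n R 2))).
  by move=> [k _ /(_ k (leqnn k))]; exists k.
have k0 : 0 < k.+1%:R^-1 :> R by rewrite invr_gt0.
have /boolp.choice[q qP] : forall i, exists q,
    x 0 i - k.+1%:R^-1 < ratr q < x 0 i + k.+1%:R^-1.
  move=> i.
  have /rat_in_itvoo[r] : x 0 i - k.+1%:R^-1 < x 0 i + k.+1%:R^-1.
    by rewrite ltrBlDr -addrA ltrDl addr_gt0.
  by rewrite in_itv => rx; exists r.
pose z : 'rV[rat]_N * nat := (\row_i q i, k).
have gz : good z.
  move=> y yz; apply: eU => i; have := yz i; rewrite !mxE /=; have := qP i.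
  move: k0 ke; move: (ratr _) (k.+1%:R^-1) => r t t0 te /andP[? ?] /andP[? ?].
  by rewrite ltr_norml; apply/andP; split; lra.
exists (pickle z) => //; rewrite /F pickleK; case: pselect => //= _ i.
rewrite !mxE /=; have := qP i.
move: (ratr _) (k.+1%:R^-1) => r t /andP[? ?].
by apply/andP; split; lra.
Qed.

Lemma open_rV_measurable U : (0 < N)%N -> open U -> measurable U.
Proof.
move=> N0 /(open_box_cover N0)[a [b [-> _]]].
by apply: bigcupT_measurable => n; exact: measurable_obox.
Qed.

Lemma closed_rV_measurable K : (0 < N)%N -> closed K -> measurable K.
Proof.
by move=> N0 /closed_openC/(open_rV_measurable N0)/measurableC; rewrite setCK.
Qed.

Lemma compact_rV_measurable K : (0 < N)%N -> compact K -> measurable K.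
Proof.
move=> N0 Kc; apply: closed_rV_measurable => //; apply: compact_closed => //.
Qed.

Lemma continuous_rV_measurable (f : 'rV[R]_N -> R) :
  (0 < N)%N -> continuous f -> measurable_fun setT f.
Proof.
move=> N0 fc; apply: (measurability _ (measurable_realfun.RGenOInfty.measurableE R)) => //.
move=> _ [_ [c ->] <-]; rewrite setTI; apply: open_rV_measurable => //.
by move/continuousP: fc; apply; exact: interval_open.
Qed.

End Boxes.

Lemma lebesgue_cbox_lty {R : realType} (n : nat) (a b : 'rV[R]_n) :
  (lebesgue_rV n (cbox a b) < +oo)%E.
Proof.
elim: n a b => [|n IH] a b; first by rewrite /= diracE ltry.
rewrite /= /lebesgue_rV_step /pushforward.
pose o : 'I_n.+1 := @lshift 1 n ord0.
pose s (c : 'rV[R]_n.+1) : 'rV[R]_n := \row_j c 0 (rshift 1 j).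
have -> : rV_cons (n := n) @^-1` cbox a b =
    cbox (s a) (s b) `*` `[a 0 o, b 0 o]%classic.
  apply/seteqP; split => [[z t] h|[z t] [/= h1 h2] i].
    split => [j|/=].
      by rewrite /s !mxE; have := h (rshift 1 j); rewrite /rV_cons (@row_mxEr _ 1 1 n).
    by have := h o; rewrite /rV_cons (@row_mxEl _ 1 1 n) mxE eqxx mulr1n in_itv.
  case: (@splitP 1 n i) => j ij.
    have -> : i = o by apply/val_inj; rewrite /= ij ord1.
    by rewrite /rV_cons (@row_mxEl _ 1 1 n) mxE eqxx mulr1n; move: h2; rewrite in_itv.
  have -> : i = rshift 1 j by apply/val_inj.
  by rewrite /rV_cons (@row_mxEr _ 1 1 n); have := h1 j; rewrite !mxE.
rewrite product_measure1E//; last exact: measurable_cbox.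
have h := lebesgue_measure_itv `[a 0 o, b 0 o].
rewrite lte_mul_pinfty ?measure_ge0 ?ge0_fin_numE ?IH ?measure_ge0//.
by rewrite [X in (X < _)%E]h; case: ifP; rewrite ?ltry// -EFinB ltry.
Qed.

Section BoxDetermined.
Context {R : realType} {N : nat}.
Local Notation mu := (@lebesgue_rV R N).
Implicit Types (a b c d y : 'rV[R]_N).

Lemma bounded_lebesgue_lty (U : set 'rV[R]_N) : measurable U -> bounded_set U ->
  (mu U < +oo)%E.
Proof.
move=> mU [M [_ /(_ (M + 1))]]; rewrite ltrDl ltr01 => /(_ isT) UM.
have UB : U `<=` cbox (const_mx (- (M + 1))) (const_mx (M + 1)).
  move=> y Uy i; rewrite !mxE -ler_norml; apply: le_trans (UM y Uy).
  rewrite [leRHS]mx_normrE.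
  exact: (le_bigmax _ (fun ij : 'I_1 * 'I_N => `|y ij.1 ij.2|) (0, i)).
apply: le_lt_trans (lebesgue_cbox_lty (const_mx (- (M + 1))) (const_mx (M + 1))).
by apply: le_measure; rewrite ?inE//; exact: measurable_cbox.
Qed.

(** Orthants form a pi-system that generates the Borel sets and whose traces on
    an open box are again open boxes with the same upper corner. *)
Definition orthant a : set 'rV[R]_N := [set y | forall i, a 0 i < y 0 i].

Lemma setI_closed_orthant : setI_closed (range orthant).
Proof.
move=> _ _ [a _ <-] [b _ <-].
exists (\row_i Num.max (a 0 i) (b 0 i)) => //.
apply/seteqP; split => y; rewrite /orthant /=.
  by move=> h; split => i; have := h i; rewrite mxE gt_max => /andP[].
by move=> [h1 h2] i; rewrite mxE gt_max h1 h2.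
Qed.

Lemma measurable_orthant_sub : measurable `<=` <<s range orthant >>.
Proof.
have sG := smallest_sigma_algebra setT (range orthant).
apply: smallest_sub => //.
move=> B; rewrite -bigcup_seq => -[i _ [C mC <-]]; rewrite setTI.
have sC : sigma_algebra setT
    [set C : set R | <<s range orthant >> (rV_coord i @^-1` C)].
  split => /=; first by rewrite preimage_set0; exact: sigma_algebra0.
  - by move=> D mD; rewrite setTD preimage_setC -setTD; exact: sigma_algebraCD.
  - by move=> F mF; rewrite preimage_bigcup; exact: sigma_algebra_bigcup.
suff h : (@ocitv R).-sigma.-measurable `<=`
    [set C : set R | <<s range orthant >> (rV_coord i @^-1` C)] by exact: h.
rewrite measurable_realfun.RGenOInfty.measurableE; apply: smallest_sub => // _ [t ->] /=.
(* A half-space is the union of orthants whose other bounds tend to -oo. *)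
rewrite (_ : _ @^-1` _ = \bigcup_(k : nat)
    orthant (\row_j (if j == i then t else - k%:R))).
  by apply: sigma_algebra_bigcup => k; apply: sub_sigma_algebra; eexists.
apply/seteqP; split => [y|y [k _ /(_ i)]]; rewrite /rV_coord /= in_itv/= andbT; last first.
  by rewrite mxE eqxx.
move=> ty; have [k kP] : exists k : nat, \sum_j `|y 0 j| < k%:R.
  exists (Num.trunc (\sum_j `|y 0 j|)).+1.
  by rewrite truncnS_gt.
exists k => // j; rewrite mxE; case: eqP => [->//|_].
rewrite ltrNl; apply: le_lt_trans kP; apply: (le_trans (ler_norm _)).
by rewrite normrN (bigD1 j)//= lerDl sumr_ge0.
Qed.

(** The Borel sets on whose trace g has integral 0 form a Dynkin system, which
    contains the orthants. *)
Lemma ae_eq0_obox c d (g : 'rV[R]_N -> \bar R) :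
  mu.-integrable (obox c d) g ->
  (forall a, (forall i, c 0 i <= a 0 i) -> (\int[mu]_(x in obox a d) g x = 0)%E) ->
  ae_eq mu (obox c d) g (cst 0%E).
Proof.
move=> gi g0; have mQ := measurable_obox c d.
set Q := obox c d in gi g0 mQ *.
pose H := [set A | measurable A /\ (\int[mu]_(x in A `&` Q) g x = 0)%E].
have mg := measurable_int _ gi.
have dH : dynkin H.
  split.
  - by split => //; rewrite setTI; apply: g0.
  - move=> A [mA A0]; split; first exact: measurableC.
    have : (\int[mu]_(x in Q) g x = 0)%E by apply: g0.
    have QE : Q = (A `&` Q) `|` (~` A `&` Q) by rewrite -setIUl setUv setTI.
    rewrite {1}QE integral_setU; [by rewrite A0 add0e|exact: measurableI| | |].
    + by apply: measurableI => //; exact: measurableC.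
    + by rewrite -QE.
    + apply/disj_setPS => x [[Ax _] [nAx _]]; exact: nAx.
  - move=> F tF FH; have mF n : measurable (F n) by have [] := FH n.
    split; first exact: bigcupT_measurable.
    have mFQ n : measurable (F n `&` Q) by exact: measurableI.
    rewrite setI_bigcupl integral_bigcup//.
    + by apply: eseries0 => n _ _; have [] := FH n.
    + exact: trivIset_setIr.
    + apply: integrableS gi => //; first exact: bigcupT_measurable.
      by move=> x [n _ []].
have GH : range orthant `<=` H.
  move=> _ [a _ <-]; split.
    rewrite (_ : orthant a = [set y | forall i, y 0 i \in `]a 0 i, +oo[]).
      exact: measurable_box.
    by apply/seteqP; split => y h i; have := h i; rewrite in_itv/= andbT.
  rewrite (_ : _ `&` _ = obox (\row_i Num.max (a 0 i) (c 0 i)) d).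
    by apply: g0 => i; rewrite mxE le_max lexx orbT.
  apply/seteqP; split => [y [h1 h2] i|y h].
    by have := h2 i; rewrite mxE gt_max h1.
  by split => i; have := h i; rewrite mxE gt_max => /andP[/andP[ac cy] yd];
    rewrite ?ac ?cy.
have mH : measurable `<=` H.
  apply: (subset_trans measurable_orthant_sub).
  rewrite -setI_closed_g_dynkin_g_sigma_algebra; last exact: setI_closed_orthant.
  exact: smallest_sub.
apply: integral_ae_eq => // E EQ mE; rewrite integral0.
by have [_] := mH E mE; rewrite setIidl.
Qed.

End BoxDetermined.

(** * Smooth functions that are flat at the origin *)
Section FlatFunctions.
Context {R : realType}.
Implicit Types (P : {poly R}) (t c d : R).

(** For polynomials P the functions P(1/t) exp(-1/t), extended by 0 to t <= 0, are
    closed under derivation; in particular they are all smooth. *)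
Definition flat P t : R := if 0 < t then P.[t^-1] * expR (- t^-1) else 0.

Definition flat_deriv P : {poly R} := 'X^2 * (P - P^`()).

Lemma exprn_expRN_le (n : nat) t : 0 <= t -> t ^+ n * expR (- t) <= n%:R ^+ n.
Proof.
move=> t0; have [->|n0] := eqVneq n 0%N.
  by rewrite !expr0 mul1r -expR0 ler_expR oppr_le0.
have nR0 : (0 : R) < n%:R by rewrite ltr0n lt0n.
rewrite expRN ler_pdivrMr ?expR_gt0//.
have -> : expR t = expR (t / n%:R) ^+ n.
  by rewrite -expRM_natl mulrC divfK// gt_eqF.
rewrite -exprMn lerXn2r ?nnegrE ?mulr_ge0 ?expR_ge0//.
rewrite -ler_pdivrMl// mulrC; apply: le_trans (expR_ge1Dx _).
by rewrite lerDr.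
Qed.

(** This is what makes the difference quotients at the origin tend to 0. *)
Lemma flat_sqr_le P : exists2 C, 0 < C & forall t, `|flat P t| <= C * t ^+ 2.
Proof.
pose C := 1 + \sum_(i < size P) `|P`_i| * i.+2%:R ^+ i.+2.
have s0 : 0 <= \sum_(i < size P) `|P`_i| * i.+2%:R ^+ i.+2.
  by apply: sumr_ge0 => i _; rewrite mulr_ge0// exprn_ge0.
have C0 : 0 < C by rewrite /C ltr_pwDl.
exists C => // t; rewrite /flat; case: ifPn => [t0|_]; last first.
  by rewrite normr0 mulr_ge0 ?sqr_ge0// ltW.
rewrite normrM (ger0_norm (expR_ge0 _)) -ler_pdivrMr ?exprn_gt0// -exprVn.
have : 0 < t^-1 by rewrite invr_gt0.
move: (t^-1) => y y0; have y0' := ltW y0.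
rewrite -mulrA; apply: (@le_trans _ _ (\sum_(i < size P) `|P`_i| * i.+2%:R ^+ i.+2)); last first.
  by rewrite /C lerDr.
rewrite horner_coef; apply: (@le_trans _ _
  ((\sum_(i < size P) `|P`_i| * y ^+ i) * (expR (- y) * y ^+ 2))).
  rewrite ler_wpM2r ?mulr_ge0 ?expR_ge0 ?sqr_ge0//.
  apply: (le_trans (ler_norm_sum _ _ _)); apply: ler_sum => i _.
  by rewrite normrM normrX (gtr0_norm y0).
rewrite mulr_suml; apply: ler_sum => i _; rewrite -mulrA ler_wpM2l//.
have := exprn_expRN_le i.+2 (ltW y0); apply: le_trans.
by rewrite mulrCA mulrC -exprD addn2.
Qed.

Lemma is_derive_flat P t : is_derive t (1 : R) (flat P) (flat (flat_deriv P) t).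
Proof.
have [t0|t0|<-] := ltgtP 0 t.
- have -> : flat (flat_deriv P) t =
      P.[t^-1] * expR (- t^-1) * t ^- 2 - P^`().[t^-1] * expR (- t^-1) * t ^- 2.
    rewrite /flat t0 /flat_deriv hornerM hornerXn hornerD hornerN exprVn; ring.
  have dV : is_derive t (1 : R) (fun y => y^-1) (- t ^- 2).
    apply: (is_derive_eq (@is_deriveV _ id t 1 1 (lt0r_neq0 t0) (is_derive_id t 1))).
    by rewrite /GRing.scale/= mulr1.
  have dP : is_derive t (1 : R) (horner P \o (fun y => y^-1)) (P^`().[t^-1] * - t ^- 2).
    exact: is_derive1_comp.
  have dE : is_derive t (1 : R) (expR \o (fun y => - y^-1)) (expR (- t^-1) * - (- t ^- 2)).
    by apply: is_derive1_comp.
  apply: (@near_eq_is_derive _ _ _ ((horner P \o (fun y => y^-1)) * (expR \o (fun y => - y^-1)))).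
    near=> y; rewrite /flat ifT//.
    by near: y; exact: lt_nbhsr.
  apply: is_derive_eq; rewrite /= /GRing.scale/=; ring.
- have -> : flat (flat_deriv P) t = 0 by rewrite /flat ltNge (ltW t0).
  apply: (@near_eq_is_derive _ _ _ (cst 0)).
  near=> y; rewrite /flat ltNge ifN// negbK ltW//.
  by near: y; exact: lt_nbhsl.
- have [C C0 CP] := flat_sqr_le P.
  have -> : flat (flat_deriv P) 0 = 0 by rewrite /flat ltxx.
  have cv : (fun h => h^-1 *: (flat P (h *: 1 + 0) - flat P 0)) @ 0^' --> (0 : R).
    apply/cvgr0Pnorm_le => e e0; near=> h.
    rewrite [flat P 0]/flat ltxx subr0 addr0 /GRing.scale/= mulr1 normrM normfV.
    have hC : `|h| <= e / C by near: h; apply: dnbhs0_le; exact: divr_gt0.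
    have [->|h0] := eqVneq h 0; first by rewrite normr0 invr0 mul0r ltW.
    rewrite mulrC ler_pdivrMr ?normr_gt0//; apply: (le_trans (CP h)).
    rewrite -real_normK ?num_real// expr2 mulrA ler_wpM2r//.
    by rewrite mulrC -ler_pdivlMr.
  by apply: DeriveDef; [exact: cvgP cv|exact: cvg_lim cv].
Unshelve. all: by end_near. Qed.

End FlatFunctions.

(** * Smooth functions of several variables *)
Section SmoothFunctions.
Context {R : realType} {N : nat}.
Implicit Types (f g phi : 'rV[R]_N -> R) (x y a b : 'rV[R]_N).

Lemma is_derive_coord (F : R -> R) (i j : 'I_N) x l :
  is_derive (x 0 i) (1 : R) F l ->
  is_derive x (delta_mx 0 j : 'rV[R]_N) (fun y => F (y 0 i)) (if i == j then l else 0).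
Proof.
have [<-|ij] := eqVneq i j => -[Fd Fl].
  have E : (fun h : R => h^-1 *: (F ((h *: (delta_mx 0 i : 'rV[R]_N) + x) 0 i) - F (x 0 i)))
      = (fun h : R => h^-1 *: (F (h *: (1 : R) + x 0 i) - F (x 0 i))).
    by apply/funext => h; rewrite !mxE !eqxx.
  by apply: DeriveDef; rewrite /derivable /derive E.
have E : (fun h : R => h^-1 *: (F ((h *: (delta_mx 0 j : 'rV[R]_N) + x) 0 i) - F (x 0 i)))
      = cst 0.
  by apply/funext => h; rewrite !mxE (negbTE ij) andbF mulr0 add0r subrr scaler0.
apply: DeriveDef; rewrite /derivable /derive E; first exact: is_cvg_cst.
exact: lim_cst.
Qed.

Lemma Ck_continuous k f : Ck k f -> continuous f.
Proof. by case: k => [|k] []. Qed.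

Lemma CkS k f : Ck k.+1 f -> Ck k f.
Proof.
elim: k f => [|k IH] f [fc fd]; first by split.
split => // i; have [fi fk] := fd i; split => //; exact: IH.
Qed.

Lemma Ck_cst k (c : R) : Ck k (fun _ : 'rV[R]_N => c).
Proof.
elim: k c => [|k IH] c; split => //; try exact: cst_continuous.
move=> i; split; first by move=> x; exact: derivable_cst.
rewrite (_ : partial i _ = fun _ => 0)//; apply/funext => x.
exact: derive_cst.
Qed.

Lemma CkD k f g : Ck k f -> Ck k g -> Ck k (fun x => f x + g x).
Proof.
elim: k f g => [|k IH] f g [fc fd] [gc gd].
  by split => // x; apply: continuousD; [exact: fc|exact: gc].
split; first by move=> x; apply: continuousD; [exact: fc|exact: gc].
move=> i; have [fi fk] := fd i; have [gi gk] := gd i; split.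
  by move=> x; apply: derivableD.
rewrite (_ : partial i _ = fun x => partial i f x + partial i g x); first exact: IH.
by apply/funext => x; exact: deriveD.
Qed.

Lemma partialM i f g x : derivable f x (delta_mx 0 i : 'rV[R]_N) ->
  derivable g x (delta_mx 0 i : 'rV[R]_N) ->
  partial i (fun x => f x * g x) x = f x * partial i g x + g x * partial i f x.
Proof. by move=> fi gi; exact: deriveM. Qed.

Lemma CkM k f g : Ck k f -> Ck k g -> Ck k (fun x => f x * g x).
Proof.
elim: k f g => [|k IH] f g fk gk; have [fc fd] := fk; have [gc gd] := gk.
  by split => // x; apply: continuousM; [exact: fc|exact: gc].
split; first by move=> x; apply: continuousM; [exact: fc|exact: gc].
move=> i; have [fi fik] := fd i; have [gi gik] := gd i; split.
  by move=> x; apply: derivableM.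
rewrite (_ : partial i _ = fun x => f x * partial i g x + g x * partial i f x).
  by apply: CkD; apply: IH => //; exact: CkS.
by apply/funext => x; exact: partialM.
Qed.

(** By induction, since the derivatives of 1/f are - f' (1/f)^2. *)
Lemma CkV k f : (forall x, f x != 0) -> Ck k f -> Ck k (fun x => (f x)^-1).
Proof.
move=> f0; elim: k => [|k IH] fk; have [fc fd] := fk.
  by split => // x; apply: continuousV => //; exact: fc.
split; first by move=> x; apply: continuousV => //; exact: fc.
move=> i; have [fi fik] := fd i; split; first by move=> x; exact: derivableV.
rewrite (_ : partial i _ = fun x => (-1) * ((f x)^-1 * ((f x)^-1 * partial i f x))).
  apply: CkM; first exact: Ck_cst.
  by apply: CkM; [exact/IH/CkS|apply: CkM => //; exact/IH/CkS].
apply/funext => x; rewrite [LHS]deriveV// /partial /GRing.scale/= -exprVn; ring.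
Qed.

Lemma Ck_prod k (I : Type) (r : seq I) (F : I -> 'rV[R]_N -> R) :
  (forall i, Ck k (F i)) -> Ck k (fun x => \prod_(i <- r) F i x).
Proof.
move=> FC; elim: r => [|i r IH].
  by under eq_fun do rewrite big_nil; exact: Ck_cst.
by under eq_fun do rewrite big_cons; exact: CkM.
Qed.

Lemma Ck_flat k (P : {poly R}) (c d : R) (i : 'I_N) :
  Ck k (fun x => flat P (c * x 0 i + d)).
Proof.
have dF Q t : is_derive t (1 : R) (fun t => flat Q (c * t + d))
    (flat (c *: flat_deriv Q) (c * t + d)).
  have dA : is_derive t (1 : R) (fun t => c * t + d) c.
    apply: is_derive_eq; rewrite /GRing.scale/=; ring.
  have dQ := is_derive_flat Q (c * t + d).
  apply: (is_derive_eq
    (@is_derive1_comp _ (flat Q) (fun t => c * t + d) t _ _ dQ dA)).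
  by rewrite /flat; case: ifP; rewrite ?mul0r// hornerZ => _; ring.
have cF Q : continuous (fun x : 'rV[R]_N => flat Q (c * x 0 i + d)).
  move=> x; apply: (@continuous_comp _ _ _ (fun y : 'rV[R]_N => y 0 i)
    (fun t => flat Q (c * t + d))); first exact: coord_continuous.
  have [fd _] := dF Q (x 0 i).
  exact/differentiable_continuous/derivable1_diffP.
elim: k P => [|k IH] P; split => // j.
have dN x := is_derive_coord j (dF P (x 0 i)).
split; first by move=> x; have [] := dN x.
rewrite (_ : partial j _ = fun x =>
  if i == j then flat (c *: flat_deriv P) (c * x 0 i + d) else 0).
  by case: eqP => _; [exact: IH|exact: Ck_cst].
by apply/funext => x; have [_ <-] := dN x.
Qed.

(** Products of exp(-1/((n+1) t)), t being the distance of a coordinate to a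
    bound: dilations make them converge to the indicator of the open box, while
    they vanish off the box. *)
Definition box_bump (n : nat) a b y : R :=
  \prod_(i < N) (flat 1 (n.+1%:R * y 0 i + - (n.+1%:R * a 0 i)) *
                 flat 1 (- n.+1%:R * y 0 i + n.+1%:R * b 0 i)).

Lemma Ck_box_bump k n a b : Ck k (box_bump n a b).
Proof. by apply: Ck_prod => i; apply: CkM; exact: Ck_flat. Qed.

Lemma flat1_01 (t : R) : 0 <= flat 1 t <= 1.
Proof.
rewrite /flat; case: ifPn => [t0|_]; last by rewrite lexx ler01.
by rewrite hornerE mul1r expR_ge0 -expR0 ler_expR oppr_le0 invr_ge0 ltW.
Qed.

Lemma flat1_gt0 (t : R) : 0 < t -> 0 < flat 1 t.
Proof. by move=> t0; rewrite /flat t0 hornerE mul1r expR_gt0. Qed.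

Lemma flat_le0 (P : {poly R}) (t : R) : t <= 0 -> flat P t = 0.
Proof. by rewrite /flat leNgt => /negbTE ->. Qed.

Lemma box_bump_01 n a b y : 0 <= box_bump n a b y <= 1.
Proof.
apply: (big_ind (fun z => 0 <= z <= 1)) => [|u v /andP[? ?] /andP[? ?]|i _].
- by rewrite ler01 lexx.
- by rewrite mulr_ge0// mulr_ile1.
- have /andP[? ?] := flat1_01 (n.+1%:R * y 0 i + - (n.+1%:R * a 0 i)).
  have /andP[? ?] := flat1_01 (- n.+1%:R * y 0 i + n.+1%:R * b 0 i).
  by rewrite mulr_ge0// mulr_ile1.
Qed.

Lemma box_bump_out n a b y : ~ obox a b y -> box_bump n a b y = 0.
Proof.
move=> /existsNP[i /negP]; rewrite negb_and -!leNgt => h.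
rewrite /box_bump (bigD1 i)//= -mulrA; case/orP: h => h.
  by rewrite flat_le0 ?mul0r// -mulrBr pmulr_rle0// subr_le0.
by rewrite (@flat_le0 _ (- _ * _ + _)) ?mul0r ?mulr0// mulNr addrC -mulrBr pmulr_rle0// subr_le0.
Qed.

Lemma test_function_box_bump n a b (U : set 'rV[R]_N) : cbox a b `<=` U ->
  test_function U (box_bump n a b).
Proof.
move=> abU; split; first by move=> k; exact: Ck_box_bump.
- exists (cbox a b); split => //; first exact: compact_cbox.
  by move=> x _ xab; apply: box_bump_out => /obox_cbox.
- by move=> x xU; apply: box_bump_out => /obox_cbox/abU.
Qed.

Lemma cvg_flat1 (t : R) : 0 < t -> flat 1 (n.+1%:R * t) @[n --> \oo] --> (1 : R).
Proof.
move=> t0.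
rewrite (_ : (fun n : nat => _) = fun n : nat => expR (- (t^-1 * n.+1%:R^-1))); last first.
  by apply/funext => n; rewrite /flat pmulr_rgt0// t0 hornerE mul1r invfM mulrC.
rewrite -[X in _ --> X]expR0; apply: continuous_cvg; first exact: continuous_expR.
rewrite -oppr0 -(mulr0 t^-1); apply: cvgN; apply: cvgMr.
exact: cvg_harmonic.
Qed.

Lemma cvg_box_bump a b y : box_bump n a b y @[n --> \oo] --> (\1_(obox a b) y : R).
Proof.
rewrite indicE; case: (boolP (y \in _)) => [|]; last first.
  rewrite notin_setE => yab; under eq_fun do rewrite box_bump_out//.
  exact: cvg_cst.
rewrite inE => yab; rewrite /box_bump.
have -> : (true%:R : R) = \prod_(i <- index_enum 'I_N) 1 by rewrite big1.
elim: (index_enum _) => [|i r IH].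
  by under eq_fun do rewrite big_nil; rewrite big_nil; exact: cvg_cst.
under eq_fun do rewrite big_cons; rewrite big_cons; apply: cvgM => //.
have /andP[ay yb] := yab i; rewrite -[X in _ --> X]mulr1.
have -> : (fun n : nat => flat 1 (n.+1%:R * y 0 i + - (n.+1%:R * a 0 i)) *
      flat 1 (- n.+1%:R * y 0 i + n.+1%:R * b 0 i)) =
    (fun n : nat => flat 1 (n.+1%:R * (y 0 i - a 0 i)) *
      flat 1 (n.+1%:R * (b 0 i - y 0 i))).
  by apply/funext => n; congr (flat 1 _ * flat 1 _); ring.
by apply: cvgM; apply: cvg_flat1; rewrite subr_gt0.
Qed.

End SmoothFunctions.

(** * Cutoff functions *)
Section Cutoff.
Context {R : realType} {N : nat}.
Implicit Types (x y a b : 'rV[R]_N) (U K : set 'rV[R]_N).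

(** The denominator never vanishes because t and 1 - t are not both <= 0. *)
Definition smooth_step (t : R) : R := flat 1 t / (flat 1 t + flat 1 (1 - t)).

Lemma smooth_step_den (t : R) : 0 < flat 1 t + flat 1 (1 - t).
Proof.
have /andP[h0 _] := flat1_01 t; have /andP[h1 _] := flat1_01 (1 - t).
have [t0|t0] := ltP 0 t; first by rewrite ltr_pwDl// flat1_gt0.
by rewrite ltr_wpDl// flat1_gt0// subr_gt0 (le_lt_trans t0).
Qed.

Lemma smooth_step_le0 (t : R) : t <= 0 -> smooth_step t = 0.
Proof. by move=> t0; rewrite /smooth_step flat_le0// mul0r. Qed.

Lemma smooth_step_ge1 (t : R) : 1 <= t -> smooth_step t = 1.
Proof.
move=> t1; rewrite /smooth_step (flat_le0 _ (t := 1 - t)) ?subr_le0// addr0.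
by rewrite divff// gt_eqF// flat1_gt0// (lt_le_trans ltr01).
Qed.

Lemma Ck_smooth_step k (c d : R) (i : 'I_N) :
  Ck k (fun x => smooth_step (c * x 0 i + d)).
Proof.
apply: CkM; first exact: Ck_flat.
apply: CkV; first by move=> x; rewrite gt_eqF// smooth_step_den.
apply: CkD; first exact: Ck_flat.
rewrite (_ : (fun x => _) = fun x : 'rV[R]_N => flat 1 (- c * x 0 i + (1 - d))).
  exact: Ck_flat.
by apply/funext => x; congr (flat 1 _); ring.
Qed.

(** Equal to 1 on the cube of centre x and half-side e, to 0 off its double. *)
Definition plateau x (e : R) y : R :=
  \prod_(i < N) (smooth_step (e^-1 * y 0 i + (2 - e^-1 * x 0 i)) *
                 smooth_step (- e^-1 * y 0 i + (2 + e^-1 * x 0 i))).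

Lemma Ck_plateau k x e : Ck k (plateau x e).
Proof. by apply: Ck_prod => i; apply: CkM; exact: Ck_smooth_step. Qed.

Lemma plateau_in x e y : 0 < e -> ball x e y -> plateau x e y = 1.
Proof.
move=> e0 [_ xy]; rewrite /plateau big1// => i _.
have := xy 0 i; rewrite /ball/= ltr_norml => /andP[h1 h2].
have e1 : e^-1 * e = 1 by rewrite mulVf// gt_eqF.
have ei : 0 < e^-1 by rewrite invr_gt0.
by rewrite !smooth_step_ge1 ?mulr1//; nra.
Qed.

Lemma plateau_out x e y : 0 < e ->
  ~ cbox (x - const_mx (2 * e)) (x + const_mx (2 * e)) y -> plateau x e y = 0.
Proof.
move=> e0 /existsNP[i /negP]; rewrite negb_and -!ltNge !mxE => h.
have e1 : e^-1 * e = 1 by rewrite mulVf// gt_eqF.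
have ei : 0 < e^-1 by rewrite invr_gt0.
rewrite /plateau (bigD1 i)//=; case/orP: h => h.
  by rewrite (@smooth_step_le0 (e^-1 * _ + _)) ?mul0r//; nra.
by rewrite (@smooth_step_le0 (- e^-1 * _ + _)) ?mulr0 ?mul0r//; nra.
Qed.

(** Finitely many plateaus over a cover of K by cubes are combined into
    1 - prod (1 - plateau). *)
Lemma smooth_cutoff U K : open U -> compact K -> K `<=` U ->
  exists eta : 'rV[R]_N -> R, [/\ forall k, Ck k eta,
    exists K', [/\ compact K', K' `<=` U & forall x, ~ K' x -> eta x = 0] &
    exists V, [/\ open V, K `<=` V & forall x, V x -> eta x = 1]].
Proof.
move=> Uo Kc KU.
have /boolp.choice[e eP] : forall x, exists e : R, 0 < e /\
    (K x -> cbox (x - const_mx (2 * e)) (x + const_mx (2 * e)) `<=` U).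
  move=> x; have [Kx|nKx] := pselect (K x); last by exists 1.
  have [e e0 eU] := open_box_sub Uo (KU _ Kx); exists (e / 3).
  split => [|_ y xy]; first by rewrite divr_gt0.
  apply: eU => i; have := xy i; rewrite !mxE => /andP[? ?].
  by rewrite ltr_norml; apply/andP; split; lra.
have e0 x : 0 < e x by have [] := eP x.
have Kcov : cover_compact K by rewrite -compact_cover.
case: (Kcov _ K (fun x => ball x (e x))).
- by move=> x _; exact: ball_open.
- by move=> x Kx; exists x => //; exact: ballxx.
move=> J0 JK0 KJ0; pose J : seq 'rV[R]_N := finmap.enum_fset J0.
have JK x : x \in J -> K x by move=> /JK0; rewrite inE.
have KJ : K `<=` \bigcup_(x in [set` J]) ball x (e x) by exact: KJ0.
pose F x := cbox (x - const_mx (2 * e x)) (x + const_mx (2 * e x)).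
pose eta y := 1 + (-1) * \prod_(x <- J) (1 + (-1) * plateau x (e x) y).
exists eta; split.
- move=> k; apply: CkD; first exact: Ck_cst.
  apply: CkM; first exact: Ck_cst.
  apply: Ck_prod => x; apply: CkD; first exact: Ck_cst.
  by apply: CkM; [exact: Ck_cst|exact: Ck_plateau].
- exists (\big[setU/set0]_(x <- J) F x); split.
  + by apply: bigsetU_compact => x _; exact: compact_cbox.
  + move=> y; rewrite -bigcup_seq => -[x /= xJ xy].
    by have [_ h] := eP x; exact: h (JK x xJ) _ xy.
  + move=> y; rewrite -bigcup_seq => yJ; rewrite /eta big_seq big1 ?mulr1 ?subrr// => x xJ.
    by rewrite plateau_out ?mulr0 ?addr0// => Fxy; apply: yJ; exists x.
- exists (\bigcup_(x in [set` J]) ball x (e x)); split => //.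
    by apply: bigcup_open => x _; exact: ball_open.
  move=> y [x /= xJ xy]; rewrite /eta (big_rem x)//= plateau_in//.
  by rewrite mulr1 subrr mul0r mulr0 addr0.
Qed.

End Cutoff.

(** * Test functions *)
Section TestFunctions.
Context {R : realType} {N : nat}.
Implicit Types (U K V : set 'rV[R]_N) (u g phi psi : 'rV[R]_N -> R).

Lemma partial_near_cst phi V (c : R) i x : open V -> V x ->
  (forall y, V y -> phi y = c) -> partial i phi x = 0.
Proof.
move=> Vo Vx phic; suff [_ <-] : is_derive x (delta_mx 0 i : 'rV[R]_N) phi 0 by [].
apply: (@near_eq_is_derive _ _ _ (cst c)).
near=> y; rewrite phic//.
by near: y; exact: open_nbhs_nbhs.
Unshelve. all: by end_near. Qed.

Lemma continuous_bounded_on_compact phi K : continuous phi -> compact K ->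
  exists C, forall x, K x -> `|phi x| <= C.
Proof.
move=> cphi Kc; have := continuous_compact (continuous_subspaceT cphi) Kc.
move=> /compact_bounded[M [_ /(_ (M + 1))]]; rewrite ltrDl ltr01 => /(_ isT) h.
by exists (M + 1) => x Kx; apply: h; exists x.
Qed.

Lemma test_function_support U phi : test_function U phi ->
  exists K, [/\ compact K, K `<=` U & forall x, ~ K x ->
    phi x = 0 /\ forall i, partial i phi x = 0].
Proof.
move=> [phiC [K [Kc KU phiK] phiU]]; exists K; split => // x Kx.
have phi0 y : ~ K y -> phi y = 0.
  by move=> Ky; have [Uy|/phiU//] := pselect (U y); exact: phiK.
split; first exact: phi0.
move=> i; apply: (@partial_near_cst _ (~` K) 0) => //.
by apply: closed_openC; exact: compact_closed.
Qed.

Lemma test_function_bounded U phi : test_function U phi ->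
  exists2 C, 0 <= C & forall x, `|phi x| <= C /\ forall i, `|partial i phi x| <= C.
Proof.
move=> phit; have [K [Kc KU K0]] := test_function_support phit.
have [phiC _ _] := phit.
have [_ dC] := phiC 1%N.
have [C CP] := continuous_bounded_on_compact (Ck_continuous (phiC 0%N)) Kc.
have /boolp.choice[D DP] : forall i : 'I_N, exists D, forall x, K x -> `|partial i phi x| <= D.
  by move=> i; apply: continuous_bounded_on_compact Kc; have [_ []] := dC i.
have s0 : 0 <= \sum_(i < N) `|D i| by exact: sumr_ge0.
exists (`|C| + \sum_(i < N) `|D i|); first by rewrite addr_ge0.
move=> x; have [Kx|/K0[phi0 dphi0]] := pselect (K x); last first.
  by split => [|i]; rewrite ?phi0 ?dphi0 normr0 addr_ge0.
split.
  by rewrite (le_trans (CP x Kx))// (le_trans (ler_norm _))// lerDl.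
move=> i; rewrite (le_trans (DP i x Kx))// (le_trans (ler_norm _))//.
by rewrite ler_wpDl// (bigD1 i)//= lerDl sumr_ge0.
Qed.

Lemma sub_test_function V U phi : V `<=` U -> test_function V phi ->
  test_function U phi.
Proof.
move=> VU [phiC [K [Kc KV phiK]] phiV]; split => //; last first.
  by move=> x Ux; apply: phiV => /VU.
exists K; split => //; first exact: subset_trans VU.
by move=> x Ux Kx; have [Vx|/phiV//] := pselect (V x); exact: phiK.
Qed.

End TestFunctions.

(** * The fundamental lemma of the calculus of variations *)
Section WeakGradient.
Context {R : realType} {N : nat} (N0 : (0 < N)%N).
Local Notation mu := (@lebesgue_rV R N).
Implicit Types (U K V : set 'rV[R]_N) (u v g phi psi : 'rV[R]_N -> R).
Implicit Types (G H : 'rV[R]_N -> 'rV[R]_N).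

Lemma integrable_lin U (f g : 'rV[R]_N -> R) (a b : R) : measurable U ->
  mu.-integrable U (EFin \o f) -> mu.-integrable U (EFin \o g) ->
  mu.-integrable U (EFin \o (fun x => a * f x + b * g x)).
Proof.
move=> mU fi gi.
have h := integrableD mU (integrableZl mU a fi) (integrableZl mU b gi).
by apply: eq_integrable h => // x _; rewrite /= -!EFinM -EFinD.
Qed.

Lemma Rintegral_lin U (f g : 'rV[R]_N -> R) (a b : R) : measurable U ->
  mu.-integrable U (EFin \o f) -> mu.-integrable U (EFin \o g) ->
  \int[mu]_(x in U) (a * f x + b * g x) =
  a * \int[mu]_(x in U) f x + b * \int[mu]_(x in U) g x.
Proof.
move=> mU fi gi; rewrite RintegralD//.
- by rewrite !RintegralZl.
- by apply: eq_integrable (integrableZl mU a fi) => // x _; rewrite /= EFinM.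
- by apply: eq_integrable (integrableZl mU b gi) => // x _; rewrite /= EFinM.
Qed.

Lemma L1locP U u : open U ->
  L1loc U u <-> (measurable_fun U u /\
    forall K, compact K -> K `<=` U -> mu.-integrable K (EFin \o u)).
Proof.
move=> Uo; have mU := open_rV_measurable N0 Uo.
split=> -[mu_ ui]; split => // K Kc KU.
  apply/integrableP; split; last exact: ui.
  by apply/measurable_EFinP; exact: measurable_funS mu_.
by have /integrableP[] := ui K Kc KU.
Qed.

Lemma L1loc_lin U u v (a b : R) : open U -> L1loc U u -> L1loc U v ->
  L1loc U (fun x => a * u x + b * v x).
Proof.
move=> Uo /(L1locP _ Uo)[mu_ ui] /(L1locP _ Uo)[mv vi]; apply/(L1locP _ Uo).
split; first by apply: measurable_funD; apply: measurable_funM => //; exact: measurable_cst.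
move=> K Kc KU; have mK := compact_rV_measurable N0 Kc.
exact: integrable_lin (ui K Kc KU) (vi K Kc KU).
Qed.

Lemma L1loc_sub V U u : open U -> open V -> V `<=` U -> L1loc U u -> L1loc V u.
Proof.
move=> Uo Vo VU [mu_ ui]; split; last by move=> K Kc KV; apply: ui => // x /KV/VU.
by apply: measurable_funS mu_ => //; exact: open_rV_measurable.
Qed.

(** All integrals of the weak formulation are of this kind. *)
Lemma integrable_L1loc_mul U u psi (C : R) K : open U -> L1loc U u ->
  continuous psi -> (forall x, `|psi x| <= C) -> compact K -> K `<=` U ->
  (forall x, ~ K x -> psi x = 0) -> mu.-integrable U (EFin \o (fun x => u x * psi x)).
Proof.
move=> Uo /(L1locP _ Uo)[mu_ ui] psic psiC Kc KU psi0.
have mU := open_rV_measurable N0 Uo; have mK := compact_rV_measurable N0 Kc.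
have iK : mu.-integrable K (EFin \o (fun x => u x * psi x)).
  have mpsi := continuous_rV_measurable N0 psic.
  have h : mu.-integrable K (fun x => C%:E * (`|u x|)%:E)%E.
    apply: integrableZl => //.
    exact: integrable_norm (ui K Kc KU).
  apply: le_integrable h => //.
    apply/measurable_EFinP; apply: measurable_funM.
      exact: measurable_funS mu_.
    exact: measurable_funS mpsi.
  move=> x Kx; rewrite /= !normrM normr_id lee_fin mulrC.
  rewrite ler_wpM2r// (le_trans (psiC x))//; exact: ler_norm.
have := (integrable_restrict mu mK mU (EFin \o (fun x => u x * psi x))).1.
rewrite setIidr// => /(_ iK); apply: eq_integrable => // x _.
rewrite patchE; case: ifPn => // /negP; rewrite inE => Kx.
by rewrite /= psi0// mulr0.
Qed.

Lemma integrable_test U u phi : open U -> L1loc U u -> test_function U phi ->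
  mu.-integrable U (EFin \o (fun x => u x * phi x)) /\
  forall i, mu.-integrable U (EFin \o (fun x => u x * partial i phi x)).
Proof.
move=> Uo uL phit; have [K [Kc KU K0]] := test_function_support phit.
have [C C0 CP] := test_function_bounded phit.
have [phiC _ _] := phit; have [phic dphi] := phiC 1%N.
split => [|i].
  by apply: (@integrable_L1loc_mul _ _ _ C K) => // x; [case: (CP x)|move=> /K0[]].
apply: (@integrable_L1loc_mul _ _ _ C K) => //.
- by have [_ []] := dphi i.
- by move=> x; have [] := CP x.
- by move=> x /K0[].
Qed.

(** On each box of a countable cover, the bumps of a smaller box with the same
    upper corner converge boundedly to its indicator, so g has integral 0 over
    these boxes and [ae_eq0_obox] applies. *)
Lemma du_bois_reymond U g : open U -> L1loc U g ->
  (forall phi, test_function U phi -> \int[mu]_(x in U) (g x * phi x) = 0) ->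
  {ae mu, forall x, U x -> g x = 0}.
Proof.
move=> Uo gL g0; have mU := open_rV_measurable N0 Uo.
have [a [b [UE abU]]] := open_box_cover N0 Uo.
have [mg gi] := (L1locP _ Uo).1 gL.
have box0 c d : cbox c d `<=` U -> ae_eq mu (obox c d) (EFin \o g) (cst 0%E).
  move=> cdU; have mc := measurable_cbox c d.
  have gc := gi _ (@compact_cbox _ _ c d) cdU.
  apply: ae_eq0_obox => [|e ce].
    by apply: integrableS gc => //; [exact: measurable_obox|exact: obox_cbox].
  have edcd : cbox e d `<=` cbox c d.
    move=> y h i; have /andP[ey ->] := h i.
    by rewrite (le_trans (ce i)).
  have mgc : measurable_fun (cbox c d) g by exact: measurable_funS mg.
  have mb (n : nat) : measurable_fun (cbox c d) (box_bump n e d).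
    apply: (@measurable_funS _ _ _ _ setT) => //.
    by apply: continuous_rV_measurable => //; exact: (Ck_continuous (Ck_box_bump 0%N n e d)).
  have mI : measurable_fun (cbox c d) (\1_(obox e d) : _ -> R).
    by apply: measurable_indic; exact: measurable_obox.
  have m1 n : measurable_fun (cbox c d) (fun x => (g x * box_bump n e d x)%:E).
    by apply/measurable_EFinP; exact: measurable_funM.
  have m2 : measurable_fun (cbox c d) (fun x => (g x * \1_(obox e d) x)%:E).
    by apply/measurable_EFinP; exact: measurable_funM.
  have cv : {ae mu, forall x, cbox c d x ->
      (g x * box_bump n e d x)%:E @[n --> \oo] --> (g x * \1_(obox e d) x)%:E}.
    apply: aeW => x _; apply: cvg_EFin; first exact: nearW.
    by apply: cvgMr; exact: cvg_box_bump.
  have dom : {ae mu, forall x n, cbox c d x ->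
      (`|(g x * box_bump n e d x)%:E| <= `|g x|%:E)%E}.
    apply: aeW => x n _; rewrite /= lee_fin normrM.
    have /andP[b0 b1] := box_bump_01 n e d x.
    by rewrite (ger0_norm b0) ler_piMr.
  have [_ _] := dominated_convergence mc m1 m2 cv (integrable_norm gc) dom.
  set f_ := (X in X @ \oo --> _) => h.
  have f0 : f_ = cst 0%E.
    apply/funext => n; rewrite /f_ /=.
    have bt : test_function U (box_bump n e d).
      by apply: test_function_box_bump; exact: subset_trans cdU.
    have := g0 _ bt; rewrite /Rintegral.
    have [bi _] := integrable_test Uo gL bt.
    have -> : (\int[mu]_(x in U) (g x * box_bump n e d x)%:E =
        \int[mu]_(x in cbox c d) (g x * box_bump n e d x)%:E)%E.
      rewrite -(setIidr cdU) integral_mkcondr; apply: eq_integral => x _.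
      rewrite patchE; case: ifPn => // /negP; rewrite inE => cx.
      by rewrite box_bump_out ?mulr0// => /obox_cbox/edcd.
    move=> /eqP; rewrite fine_eq0; first by move=> /eqP.
    apply: integrable_fin_num => //; apply: integrableS bi => //.
  have I0 : (\int[mu]_(x in cbox c d) (g x * \1_(obox e d) x)%:E = 0)%E.
    by rewrite f0 in h; rewrite -(cvg_lim _ h)//; exact: lim_cst.
  have oE : obox e d = cbox c d `&` obox e d.
    by rewrite setIidr//; exact: subset_trans (@obox_cbox _ _ e d) edcd.
  rewrite oE -[RHS]I0 integral_mkcondr; apply: eq_integral => x _.
  by rewrite patchE indicE /=; case: ifPn => xe; rewrite ?mulr1 ?mulr0.
suff /ae_foralln : forall n, {ae mu, forall x, obox (a n) (b n) x -> g x = 0}.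
  apply: filterS => x h; rewrite UE => -[n _]; exact: h.
by move=> n; have := box0 _ _ (abU n); apply: filterS => x /[apply] -[].
Qed.

End WeakGradient.

(** * Weak gradients *)
Section WeakGradientTheory.
Context {R : realType} {N : nat} (N0 : (0 < N)%N).
Local Notation mu := (@lebesgue_rV R N).
Implicit Types (U K V : set 'rV[R]_N) (u v g phi psi : 'rV[R]_N -> R).
Implicit Types (G H : 'rV[R]_N -> 'rV[R]_N).

Lemma weak_gradient_lin U u v G H (a b : R) : open U ->
  weak_gradient U u G -> weak_gradient U v H ->
  weak_gradient U (fun x => a * u x + b * v x) (fun x => a *: G x + b *: H x).
Proof.
move=> Uo [uL GL uG] [vL HL vH]; have mU := open_rV_measurable N0 Uo.
split; first exact: L1loc_lin.
  move=> i; have := L1loc_lin N0 a b Uo (GL i) (HL i).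
  by congr (L1loc U _); apply/funext => x; rewrite !mxE.
move=> phi i phit.
have [ui /(_ i) udi] := integrable_test N0 Uo uL phit.
have [vi /(_ i) vdi] := integrable_test N0 Uo vL phit.
have [Gi _] := integrable_test N0 Uo (GL i) phit.
have [Hi _] := integrable_test N0 Uo (HL i) phit.
transitivity (\int[mu]_(x in U) (a * (u x * partial i phi x) + b * (v x * partial i phi x))).
  by apply: eq_Rintegral => x _; ring.
rewrite Rintegral_lin// uG// vH//.
transitivity (- \int[mu]_(x in U) (a * (G x 0 i * phi x) + b * (H x 0 i * phi x))).
  by rewrite Rintegral_lin//; ring.
by congr (- _); apply: eq_Rintegral => x _; rewrite !mxE; ring.
Qed.

(** Test functions of V are test functions of U, and against them v is zero. *)
Lemma weak_gradient_local U V v G : open U -> open V -> V `<=` U ->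
  weak_gradient U v G -> (forall x, V x -> v x = 0) ->
  {ae mu, forall x, V x -> G x = 0}.
Proof.
move=> Uo Vo VU [vL GL vG] v0; have mU := open_rV_measurable N0 Uo.
have h (i : 'I_N) : {ae mu, forall x, V x -> G x 0 i = 0}.
  apply: du_bois_reymond => //; first exact: L1loc_sub (GL i).
  move=> phi phit; have phitU := sub_test_function VU phit.
  have [K [_ KV K0]] := test_function_support phit.
  have := vG phi i phitU.
  rewrite (_ : \int[mu]_(x in U) (v x * partial i phi x) = 0); last first.
    rewrite [LHS](_ : _ = \int[mu]_(x in U) (cst 0 x)); first by rewrite Rintegral_cst// mul0r.
    apply: eq_Rintegral => x _; have [Kx|/K0[_ ->]] := pselect (K x).
      by rewrite v0 ?mul0r//; exact: KV.
    by rewrite mulr0.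
  move=> /esym/eqP; rewrite oppr_eq0 => /eqP <-.
  rewrite -{1}(setIidr VU) Rintegral_mkcondr; apply: eq_Rintegral => x _.
  rewrite patchE; case: ifPn => // /negP; rewrite inE => Vx.
  by have [|-> _] := K0 x; rewrite ?mulr0// => /KV.
have : {ae mu, forall x (i : 'I_N), V x -> G x 0 i = 0} by apply: filter_forall.
by apply: filterS => x hx Vx; apply/rowP => i; rewrite mxE hx.
Qed.

Lemma weak_gradient_unique U u G H : open U ->
  weak_gradient U u G -> weak_gradient U u H ->
  {ae mu, forall x, U x -> G x = H x}.
Proof.
move=> Uo uG uH; have := weak_gradient_lin 1 (-1) Uo uG uH.
move=> /(weak_gradient_local Uo Uo (@subset_refl _ U)) h.
have : {ae mu, forall x, U x -> 1 *: G x + -1 *: H x = 0}.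
  by apply: h => x _; ring.
apply: filterS => x /[apply]; rewrite scale1r scaleN1r => /eqP.
by rewrite subr_eq0 => /eqP.
Qed.

Lemma weak_gradient_grad U u : (exists G, weak_gradient U u G) -> weak_gradient U u (grad U u).
Proof. exact: (@xgetPex _ (fun=> 0) [set G | weak_gradient U u G]). Qed.

Lemma grad_ae U u G : open U -> weak_gradient U u G ->
  {ae mu, forall x, U x -> grad U u x = G x}.
Proof.
by move=> Uo uG; apply: (weak_gradient_unique Uo _ uG); apply: weak_gradient_grad; exists G.
Qed.

End WeakGradientTheory.

(** * The modular and the Luxemburg norm *)
Lemma measurable_powR_fun {R : realType} d (T : measurableType d) (D : set T)
  (f q : T -> R) : measurable D -> measurable_fun D f -> measurable_fun D q ->
  measurable_fun D (fun x => f x `^ q x).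
Proof.
move=> mD mf mq.
have h : measurable_fun D (fun x => \1_[set (0 : R)] (f x) * \1_[set (0 : R)] (q x)
    + \1_(~` [set (0 : R)]) (f x) * expR (q x * ln (f x))).
  apply: measurable_funD; apply: measurable_funM.
  - by apply: measurableT_comp => //; exact: measurable_indic.
  - by apply: measurableT_comp => //; exact: measurable_indic.
  - by apply: measurableT_comp => //; apply: measurable_indic; exact: measurableC.
  - apply: measurableT_comp => //; apply: measurable_funM => //.
    exact: measurableT_comp.
apply: eq_measurable_fun h => x _; rewrite !indicE in_setC !in_set1 /powR.
by case: eqP => _; rewrite /= ?mul1r ?mul0r ?addr0 ?add0r.
Qed.

Section Modular.
Context {R : realType} {N : nat}.
Local Notation mu := (@lebesgue_rV R N).
Context (U : set 'rV[R]_N) (p : 'rV[R]_N -> R) (M : R).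
Context (mU : measurable U) (mp : measurable_fun U p).
Context (p1 : forall x, U x -> 1 <= p x) (pM : forall x, U x -> p x <= M).
Implicit Types (f g h : 'rV[R]_N -> R) (l m c : R).

Local Notation rho := (modular U p).

Lemma measurable_powR_exponent g : measurable_fun U g ->
  measurable_fun U (fun x => `|g x| `^ p x).
Proof.
by move=> mg; apply: measurable_powR_fun => //; exact: measurableT_comp.
Qed.

Lemma measurable_modular g : measurable_fun U g ->
  measurable_fun U (fun x => (`|g x| `^ p x)%:E).
Proof. by move=> mg; apply/measurable_EFinP; exact: measurable_powR_exponent. Qed.

Lemma modular_ge0 g : (0 <= rho g)%E.
Proof. by apply: integral_ge0 => x _; rewrite lee_fin powR_ge0. Qed.

Lemma modular_ae g h : measurable_fun U g -> measurable_fun U h ->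
  {ae mu, forall x, U x -> `|g x| = `|h x|} -> rho g = rho h.
Proof.
move=> mg mh gh; apply: ae_eq_integral => //; try exact: measurable_modular.
by apply: filterS gh => x /[apply] ->.
Qed.

Lemma modular_le g h : measurable_fun U g -> measurable_fun U h ->
  (forall x, U x -> `|g x| <= `|h x|) -> (rho g <= rho h)%E.
Proof.
move=> mg mh gh; apply: ge0_le_integral => //; try exact: measurable_modular.
- move=> x Ux; rewrite lee_fin ge0_ler_powR ?nnegrE ?normr_ge0 ?gh//.
  exact: le_trans (p1 Ux).
Qed.

Lemma modular_mull c g : measurable_fun U g -> 0 <= c ->
  (c%:E * rho g = \int[mu]_(x in U) (c * `|g x| `^ p x)%:E)%E.
Proof.
move=> mg c0; under eq_integral do rewrite EFinM.
by rewrite ge0_integralZl//; exact: measurable_modular.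
Qed.

Lemma measurable_modular_mull c g : measurable_fun U g ->
  measurable_fun U (fun x => (c * `|g x| `^ p x)%:E).
Proof.
move=> mg; apply/measurable_EFinP; apply: measurable_funM => //.
exact: measurable_powR_exponent.
Qed.

Lemma modular_scale_le1 q c g : measurable_fun U g ->
  (forall x, U x -> q <= p x) -> 0 < c <= 1 ->
  (rho (fun x => c * g x)%R <= (c `^ q)%:E * rho g)%E.
Proof.
move=> mg qp /andP[c0 c1]; rewrite modular_mull ?powR_ge0//.
apply: ge0_le_integral => //.
- by apply: measurable_modular; apply: measurable_funM.
- exact: measurable_modular_mull.
- move=> x Ux; rewrite lee_fin normrM powRM// ler_wpM2r ?powR_ge0//.
  by rewrite gtr0_norm// ger_powR ?c0// qp.
Qed.

(** A substitute for the convexity of the modular: |h(x)|^p(x) is at most one of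
    the two other integrands. *)
Lemma modular_max f g h : measurable_fun U f -> measurable_fun U g ->
  measurable_fun U h -> (forall x, U x -> `|h x| <= Num.max `|f x| `|g x|) ->
  (rho h <= rho f + rho g)%E.
Proof.
move=> mf mg mh hfg.
have -> : (rho f + rho g =
    \int[mu]_(x in U) (`|f x| `^ p x + `|g x| `^ p x)%:E)%E.
  under eq_integral do rewrite EFinD.
  by rewrite ge0_integralD//; try exact: measurable_modular;
    move=> x _; rewrite lee_fin powR_ge0.
apply: ge0_le_integral => //.
- exact: measurable_modular.
- by apply/measurable_EFinP; apply: measurable_funD; exact: measurable_powR_exponent.
- move=> x Ux; rewrite lee_fin.
  have p0 : 0 <= p x by exact: le_trans (p1 Ux).
  have := hfg x Ux; rewrite le_max => /orP[] hx.
    by rewrite ler_wpDr ?powR_ge0// ge0_ler_powR.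
  by rewrite ler_wpDl ?powR_ge0// ge0_ler_powR.
Qed.

Lemma modular_scale_ge1 l g : measurable_fun U g -> 1 <= l ->
  (rho (fun x => l * g x)%R <= (l `^ M)%:E * rho g)%E.
Proof.
move=> mg l1; rewrite modular_mull ?powR_ge0//; apply: ge0_le_integral => //.
- by apply: measurable_modular; apply: measurable_funM.
- exact: measurable_modular_mull.
- move=> x Ux; rewrite lee_fin normrM powRM// ler_wpM2r ?powR_ge0//.
  by rewrite ger0_norm ?(le_trans _ l1)// ler_powR// pM.
Qed.

(** The scales whose infimum is [Lp_norm U p g]. *)
Definition admissible g : set R := [set l | 0 < l /\ (rho (fun x => g x / l)%R < 1)%E].

Lemma admissible_gt0 g l : admissible g l -> 0 < l. Proof. by case. Qed.

Lemma admissible_le g l m : measurable_fun U g -> admissible g l -> l <= m -> admissible g m.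
Proof.
move=> mg [l0 gl] lm; have m0 := lt_le_trans l0 lm; split; first exact: m0.
apply: le_lt_trans gl; apply: modular_le => [||x _];
  try by apply: measurable_funM.
by rewrite !normrM ler_wpM2l// !normfV lef_pV2 ?posrE ?normr_gt0 ?gt_eqF// !gtr0_norm.
Qed.

Lemma admissible_neq0 g : measurable_fun U g -> (rho g < +oo)%E -> admissible g !=set0.
Proof.
move=> mg goo; have gfin : rho g \is a fin_num by rewrite ge0_fin_numE ?modular_ge0.
have g0 : 0 <= fine (rho g) by rewrite fine_ge0// modular_ge0.
exists (fine (rho g) + 2); split; first by rewrite ltr_wpDl.
under eq_fun do rewrite mulrC.
apply: (le_lt_trans (modular_scale_le1 mg p1 _)).
  by rewrite invr_gt0 ltr_wpDl//= invf_le1 ?ltr_wpDl//; lra.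
rewrite powRr1 ?invr_ge0 ?addr_ge0//.
rewrite -(fineK gfin) -EFinM lte_fin mulrC ltr_pdivrMr ?ltr_wpDl// mul1r.
by rewrite ltrDl.
Qed.

Lemma Lp_norm_ge0 g : 0 <= Lp_norm U p g.
Proof.
suff : 0 <= inf (admissible g) by apply.
have [->|/set0P gn0] := eqVneq (admissible g) set0; first by rewrite inf0.
by apply: lb_le_inf => // l [/ltW l0 _]; exact: l0.
Qed.

Lemma Lp_norm_le g l : admissible g l -> Lp_norm U p g <= l.
Proof. by move=> gl; apply: ge_inf => //; exists 0 => m [/ltW]. Qed.

Lemma admissible_Lp_norm g l : measurable_fun U g -> (rho g < +oo)%E ->
  Lp_norm U p g < l -> admissible g l.
Proof.
move=> mg goo gl.
have gi : has_inf (admissible g) by split; [exact: admissible_neq0|exists 0 => m [/ltW]].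
have d0 : 0 < l - Lp_norm U p g by rewrite subr_gt0.
have [m gm ml] := inf_adherent d0 gi.
by apply: admissible_le gm _ => //; rewrite -/(Lp_norm U p g) subrKC in ml; exact: ltW.
Qed.

(** The triangle inequality up to a constant: |h / k| is at most half the maximum
    of |f / l| and |g / m|, and the factor 1/2 leaves the modular, so that the
    sum of two modulars < 1 is again < 1. *)
Lemma admissible_lin f g h (a b l m k : R) : measurable_fun U f -> measurable_fun U g ->
  measurable_fun U h -> admissible f l -> admissible g m ->
  (forall x, U x -> `|h x| <= `|a| * `|f x| + `|b| * `|g x|) ->
  0 < k -> 4 * (`|a| * l) <= k -> 4 * (`|b| * m) <= k -> admissible h k.
Proof.
move=> mf mg mh [l0 fl] [m0 gm] hfg k0 kl km; split; first exact: k0.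
have mdiv (q : 'rV[R]_N -> R) c : measurable_fun U q -> measurable_fun U (fun x => q x / c).
  by move=> mq; apply: measurable_funM.
have -> : (fun x => h x / k) = (fun x => 2^-1 * (2 * (h x / k))).
  by apply/funext => x; rewrite mulKf.
have m2 : measurable_fun U (fun x => 2 * (h x / k)).
  by apply: measurable_funM => //; exact: mdiv.
apply: (le_lt_trans (modular_scale_le1 m2 p1 _)); first by apply/andP; split; lra.
rewrite powRr1 ?invr_ge0//.
have h2 : (rho (fun x => 2 * (h x / k))%R <=
    rho (fun x => f x / l)%R + rho (fun x => g x / m)%R)%E.
  apply: modular_max => //; try exact: mdiv.
  move=> x Ux; rewrite !normrM !normfV (gtr0_norm l0) (gtr0_norm m0) (gtr0_norm k0).
  rewrite (ger0_norm (x := 2))// mulrA ler_pdivrMr//.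
  have := hfg x Ux; set F := `|f x|; set G := `|g x| => hx.
  have F0 : 0 <= F / l by rewrite divr_ge0 ?normr_ge0 ?(ltW l0).
  have G0 : 0 <= G / m by rewrite divr_ge0 ?normr_ge0 ?(ltW m0).
  set Z := Num.max _ _.
  have FZ : F / l <= Z by rewrite le_max lexx.
  have GZ : G / m <= Z by rewrite le_max lexx orbT.
  have E1 : F = F / l * l by rewrite divfK// gt_eqF.
  have E2 : G = G / m * m by rewrite divfK// gt_eqF.
  have h1 : 4 * (`|a| * F) <= Z * k.
    rewrite E1 (_ : 4 * _ = F / l * (4 * (`|a| * l))); last by ring.
    by rewrite ler_pM// !mulr_ge0 ?normr_ge0 ?(ltW l0).
  have h3 : 4 * (`|b| * G) <= Z * k.
    rewrite E2 (_ : 4 * _ = G / m * (4 * (`|b| * m))); last by ring.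
    by rewrite ler_pM// !mulr_ge0 ?normr_ge0 ?(ltW m0).
  lra.
have h1 : (rho (fun x => f x / l)%R + rho (fun x => g x / m)%R < 2%:E)%E.
  by rewrite (_ : 2%:E = 1 + 1)%E; [exact: (lteD fl gm)|rewrite -EFinD].
apply: (@le_lt_trans _ _ (2^-1%:E * (rho (fun x => f x / l)%R + rho (fun x => g x / m)%R))%E).
  by rewrite lee_pmul2l// lte_fin invr_gt0.
by rewrite muleC -lte_pdivlMr// ?invr_gt0// invrK mul1e.
Qed.

Lemma admissible_congr f g l : measurable_fun U f -> measurable_fun U g ->
  {ae mu, forall x, U x -> `|f x| = `|g x|} -> admissible f l -> admissible g l.
Proof.
move=> mf mg fg [l0 fl]; split; first exact: l0.
rewrite -(@modular_ae (fun x => f x / l)); first exact: fl.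
- by apply: measurable_funM.
- by apply: measurable_funM.
- by apply: filterS fg => x /[apply] fgx; rewrite !normrM fgx.
Qed.

Lemma Lp_norm_congr f g : measurable_fun U f -> measurable_fun U g ->
  {ae mu, forall x, U x -> `|f x| = `|g x|} -> Lp_norm U p f = Lp_norm U p g.
Proof.
move=> mf mg fg.
have gf : {ae mu, forall x, U x -> `|g x| = `|f x|} by apply: filterS fg => x /[apply].
have E : admissible f = admissible g.
  by apply/seteqP; split => l; [exact: admissible_congr fg|exact: admissible_congr gf].
exact: (f_equal inf E).
Qed.

(** Since t <= 1 + t^p; hence convergence in norm implies convergence in L^1. *)
Lemma admissible_integral_le g l : measurable_fun U g -> admissible g l ->
  (\int[mu]_(x in U) (`|g x|)%:E <= l%:E * (mu U + 1))%E.
Proof.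
move=> mg [l0 gl]; have mgl : measurable_fun U (fun x => g x / l) by apply: measurable_funM.
apply: (@le_trans _ _ (l%:E * \int[mu]_(x in U) (1 + `|g x / l| `^ p x)%:E)%E); last first.
  rewrite lee_pmul2l//; rewrite [leLHS](_ : _ = mu U + rho (fun x => g x / l)%R)%E.
    by rewrite leeD2l// ltW.
  transitivity (\int[mu]_(x in U) (1%:E + (`|g x / l| `^ p x)%:E))%E.
    exact: eq_integral.
  rewrite ge0_integralD//; last exact: measurable_modular.
  by rewrite integral_cst// mul1e.
have -> : (l%:E * \int[mu]_(x in U) (1 + `|g x / l| `^ p x)%:E =
    \int[mu]_(x in U) (l * (1 + `|g x / l| `^ p x))%:E)%E.
  under [RHS]eq_integral do rewrite EFinM.
  rewrite ge0_integralZl ?lee_fin ?ltW//.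
  by apply/measurable_EFinP; apply: measurable_funD => //; exact: measurable_powR_exponent.
apply: ge0_le_integral => //.
- by apply/measurable_EFinP; exact: measurableT_comp.
- apply/measurable_EFinP; apply: measurable_funM => //; apply: measurable_funD => //.
  exact: measurable_powR_exponent.
- move=> x Ux; rewrite lee_fin mulrC -ler_pdivrMr//.
  rewrite -[X in _ / X](gtr0_norm l0) -normfV -normrM.
  have [n1|n1] := leP `|g x / l| 1; first by rewrite ler_wpDr// powR_ge0.
  by rewrite ler_wpDl// le1r_powR ?p1// ltW.
Qed.

End Modular.

(** * Sobolev spaces with variable exponent *)
Section SobolevSpaces.
Context {R : realType} {N : nat} (N0 : (0 < N)%N).
Local Notation mu := (@lebesgue_rV R N).
Context (U : set 'rV[R]_N) (p : 'rV[R]_N -> R).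
Context (Uo : open U) (Ub : bounded_set U) (pU : variable_exponent U p).
Implicit Types (f g h u v w : 'rV[R]_N -> R) (G H : 'rV[R]_N -> 'rV[R]_N).

Local Notation rho := (modular U p).

Let mU : measurable U := open_rV_measurable N0 Uo.
Let mp : measurable_fun U p. Proof. by case: pU. Qed.
Let p1 : forall x, U x -> 1 <= p x. Proof. by case: pU. Qed.
Let muU : (mu U < +oo)%E. Proof. exact: bounded_lebesgue_lty. Qed.

Definition finite_modular g : Prop := measurable_fun U g /\ (rho g < +oo)%E.

Lemma finite_modular_lin f g h (a b : R) : finite_modular f -> finite_modular g ->
  measurable_fun U h ->
  (forall x, U x -> `|h x| <= `|a| * `|f x| + `|b| * `|g x|) ->
  finite_modular h.
Proof.
move=> [mf ff] [mg fg] mh hfg; split; first exact: mh.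
have [M pM] : exists M : R, forall x, U x -> p x <= M by case: pU.
have [l fl] := admissible_neq0 mU mp p1 mf ff.
have [m gm] := admissible_neq0 mU mp p1 mg fg.
have l0 := admissible_gt0 fl; have m0 := admissible_gt0 gm.
have al : 0 <= `|a| * l by rewrite mulr_ge0// ltW.
have bm : 0 <= `|b| * m by rewrite mulr_ge0// ltW.
pose k := 1 + (4 * (`|a| * l) + 4 * (`|b| * m)).
have k0 : 0 < k by rewrite /k; lra.
have [_ hk] : admissible U p h k.
  by apply: (admissible_lin mU mp p1 mf mg mh fl gm hfg) => //; rewrite /k; lra.
have -> : h = (fun x => k * (h x / k)).
  by apply/funext => x; rewrite mulrC divfK// gt_eqF.
apply: (le_lt_trans (modular_scale_ge1 mU mp pM _ _)).
- by apply: measurable_funM.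
- by rewrite /k; lra.
- apply: lte_mul_pinfty; [by rewrite lee_fin powR_ge0|by []|].
  exact: lt_trans hk (ltry _).
Qed.

Lemma finite_modular_integrable g : finite_modular g -> mu.-integrable U (EFin \o g).
Proof.
move=> [mg fg]; apply/integrableP; split; first exact/measurable_EFinP.
have [l gl] := admissible_neq0 mU mp p1 mg fg.
apply: (le_lt_trans (admissible_integral_le mU mp p1 mg gl)).
by rewrite lte_mul_pinfty ?lee_fin ?(ltW (admissible_gt0 gl))// lte_add_pinfty// ltry.
Qed.

Lemma LpP g : Lp U p g <-> finite_modular g.
Proof.
split=> [[[mg _] fg]//|fg]; have [mg gfin] := fg; split => //; split => // K Kc KU.
have mK := compact_rV_measurable N0 Kc.
have /integrableP[_] := finite_modular_integrable fg; apply: le_lt_trans.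
apply: ge0_subset_integral => //.
by apply/measurable_EFinP; exact: measurableT_comp.
Qed.

Lemma measurable_enorm G : (forall i, measurable_fun U (fun x => G x 0 i)) ->
  measurable_fun U (fun x => enorm (G x)).
Proof.
move=> mG; apply: (@measurableT_comp _ _ _ _ _ _ (@Num.sqrt R)).
  by apply: continuous_measurable_fun; exact: sqrt_continuous.
by apply: measurable_sum => i; apply: measurable_funM; exact: mG.
Qed.

Lemma finite_modular_enorm G : (forall i, finite_modular (fun x => G x 0 i)) ->
  finite_modular (fun x => enorm (G x)).
Proof.
move=> fG; have mG i : measurable_fun U (fun x => G x 0 i) by case: (fG i).
have fs : finite_modular (fun x => \sum_(i < N) `|G x 0 i|).
  elim: (index_enum _) => [|i r [mr fr]].
    under eq_fun do rewrite big_nil.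
    split; first exact: measurable_cst.
    rewrite /modular (eq_integral (cst 0%E)) ?integral0 ?ltry// => x.
    rewrite inE => Ux; rewrite /= normr0 powR0// gt_eqF//.
    by rewrite (lt_le_trans _ (p1 Ux)).
  under eq_fun do rewrite big_cons.
  apply: (@finite_modular_lin (fun x => G x 0 i) (fun x => \sum_(j <- r) `|G x 0 j|) _ 1 1) => //.
    by apply: measurable_funD => //; exact: measurableT_comp.
  move=> x _; rewrite !normr1 !mul1r (le_trans (ler_normD _ _))//.
  by rewrite normr_id.
apply: (@finite_modular_lin _ _ _ 1 0 fs fs); first exact: measurable_enorm.
move=> x _; rewrite normr1 normr0 mul1r mul0r addr0 ger0_norm ?enorm_ge0//.
by rewrite (le_trans (enorm_le_sum _))// ler_norm.
Qed.

Lemma finite_modular_coord G i : measurable_fun U (fun x => G x 0 i) ->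
  finite_modular (fun x => enorm (G x)) -> finite_modular (fun x => G x 0 i).
Proof.
move=> mG fG; apply: (@finite_modular_lin _ _ _ 1 0 fG fG) => // x _.
rewrite normr1 normr0 mul1r mul0r addr0 (ger0_norm (enorm_ge0 _)).
exact: abs_coord_le_enorm.
Qed.

(** [W1p] with a freely chosen representative of the weak gradient in place of
    [grad], which is stable under linear combinations and extension by zero. *)
Definition sobolev u G : Prop :=
  [/\ weak_gradient U u G, finite_modular u & finite_modular (fun x => enorm (G x))].

Lemma weak_gradient_measurable u G : weak_gradient U u G ->
  forall i, measurable_fun U (fun x => G x 0 i).
Proof. by move=> [_ GL _] i; case: (GL i). Qed.

Lemma W1p_sobolev u : W1p U p u -> sobolev u (grad U u).
Proof.
move=> [uG fu fG]; split; [exact: weak_gradient_grad|exact: (LpP _).1 fu|].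
by apply: finite_modular_enorm => i; exact: (LpP _).1 (fG i).
Qed.

Lemma sobolev_W1p u G : sobolev u G -> W1p U p u.
Proof.
move=> [uG fu [mG fG]]; split; [by exists G|exact: (LpP _).2 fu|].
have ug : weak_gradient U u (grad U u) by apply: weak_gradient_grad; exists G.
move=> i; apply: (LpP _).2; apply: finite_modular_coord.
  exact: weak_gradient_measurable ug i.
have mg := measurable_enorm (weak_gradient_measurable ug).
split; first exact: mg.
rewrite (modular_ae mU mp mg mG); first exact: fG.
by apply: filterS (grad_ae N0 Uo uG) => x /[apply] ->.
Qed.

Lemma sobolev_grad_norm u G : sobolev u G ->
  grad_norm U p u = Lp_norm U p (fun x => enorm (G x)).
Proof.
move=> [uG fu [mG fG]]; have ug : weak_gradient U u (grad U u) by apply: weak_gradient_grad; exists G.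
apply: Lp_norm_congr => //; first exact: measurable_enorm (weak_gradient_measurable ug).
by apply: filterS (grad_ae N0 Uo uG) => x /[apply] ->.
Qed.

Lemma sobolev_lin u v G H (a b : R) : sobolev u G -> sobolev v H ->
  sobolev (fun x => a * u x + b * v x) (fun x => a *: G x + b *: H x).
Proof.
move=> [uG fu fG] [vH fv fH]; have wL := weak_gradient_lin N0 a b Uo uG vH.
split; first exact: wL.
  apply: (@finite_modular_lin _ _ _ a b fu fv).
    by have [[]] := wL.
  by move=> x _; rewrite (le_trans (ler_normD _ _))// !normrM.
apply: (@finite_modular_lin _ _ _ a b fG fH).
  exact: measurable_enorm (weak_gradient_measurable wL).
move=> x _; rewrite !(ger0_norm (enorm_ge0 _)).
have := enorm_triangle (a *: G x) (- (b *: H x)).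
by rewrite opprK -scaleNr !enormZ normrN.
Qed.

Lemma sobolevB u v G H : sobolev u G -> sobolev v H ->
  sobolev (fun x => u x - v x) (fun x => G x - H x).
Proof.
move=> uG vH; have := sobolev_lin 1 (-1) uG vH.
by congr sobolev; apply/funext => x; rewrite ?mul1r ?mulN1r ?scale1r ?scaleN1r.
Qed.

(** Convergence in norm, expressed by scales: the two norms are nonnegative, so
    their sum is small if and only if both are. *)
Lemma W1p0P u G : sobolev u G ->
  W1p0 U p u <-> forall e : R, 0 < e -> exists v H,
    [/\ sobolev v H, supported_in U v, admissible U p (fun x => u x - v x) e &
        admissible U p (fun x => enorm (G x - H x)) e].
Proof.
move=> uG; have uW := sobolev_W1p uG.
have split_lt (a b e : R) : 0 <= a -> 0 <= b -> a + b < e -> a < e /\ b < e.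
  by move=> a0 b0 abe; split; lra.
split=> [[_ h] e e0|h].
  have [v [vW vs ve]] := h e e0; exists v, (grad U v).
  have vH := W1p_sobolev vW; have dH := sobolevB uG vH.
  have [_ [m1 f1] [m2 f2]] := dH.
  have n1 := Lp_norm_ge0 U p (fun x => u x - v x).
  have n2 := Lp_norm_ge0 U p (fun x => enorm (G x - grad U v x)).
  move: ve; rewrite /W1p_norm (sobolev_grad_norm dH) => ve.
  split; [exact: vH|exact: vs| |].
    exact: (admissible_Lp_norm mU mp p1 m1 f1 (split_lt _ _ _ n1 n2 ve).1).
  exact: (admissible_Lp_norm mU mp p1 m2 f2 (split_lt _ _ _ n1 n2 ve).2).
split; first exact: uW.
move=> e e0; have e3 : 0 < e / 3 by rewrite divr_gt0.
have e2 : e / 3 + e / 3 < e by lra.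
have [v [H [vH vs l1 l2]]] := h _ e3; exists v.
split; [exact: sobolev_W1p vH|exact: vs|].
have n1 : Lp_norm U p (u \- v) <= e / 3 := Lp_norm_le l1.
have n2 : grad_norm U p (u \- v) <= e / 3.
  have -> : grad_norm U p (u \- v) = Lp_norm U p (fun x => enorm (G x - H x)).
    exact: sobolev_grad_norm (sobolevB uG vH).
  exact: Lp_norm_le l2.
exact: le_lt_trans (lerD n1 n2) e2.
Qed.

Lemma W1p0_lin u v (a b : R) : W1p0 U p u -> W1p0 U p v ->
  W1p0 U p (fun x => a * u x + b * v x).
Proof.
move=> u0 v0; have [uW _] := u0; have [vW _] := v0.
have uG := W1p_sobolev uW; have vG := W1p_sobolev vW.
have wG := sobolev_lin a b uG vG; apply/(W1p0P wG) => e e0.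
pose d := e / (4 * (`|a| + `|b| + 1)).
have c0 : 0 < `|a| + `|b| + 1 by rewrite ltr_wpDl// addr_ge0.
have d0 : 0 < d by rewrite divr_gt0// mulr_gt0.
have ed : e = 4 * ((`|a| + `|b| + 1) * d).
  by rewrite /d; field; rewrite gt_eqF.
(* d is chosen for the two smallness conditions of [admissible_lin]. *)
have ae : 4 * (`|a| * d) <= e by rewrite ed ler_pM2l// ler_pM2r// -addrA lerDl addr_ge0.
have be : 4 * (`|b| * d) <= e.
  by rewrite ed ler_pM2l// ler_pM2r// addrAC lerDr addr_ge0.
have [u' [G' [uG' us lu lG]]] := (W1p0P uG).1 u0 d d0.
have [v' [H' [vH' vs lv lH]]] := (W1p0P vG).1 v0 d d0.
have wG' := sobolev_lin a b uG' vH'.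
exists (fun x => a * u' x + b * v' x), (fun x => a *: G' x + b *: H' x).
have mm f g F F' : sobolev f F -> sobolev g F' ->
    measurable_fun U (fun x => f x - g x) /\
    measurable_fun U (fun x => enorm (F x - F' x)).
  by move=> fF gF; have [_ [m1 _] [m2 _]] := sobolevB fF gF.
have [mu1 mG1] := mm _ _ _ _ uG uG'; have [mv1 mH1] := mm _ _ _ _ vG vH'.
have [mw1 mw2] := mm _ _ _ _ wG wG'.
split; first exact: wG'.
- have [K [Kc KU K0]] := us; have [L [Lc LU L0]] := vs.
  exists (K `|` L); split; first exact: compactU.
    by move=> x [/KU|/LU].
  move=> x Ux KLx; rewrite K0 ?L0 ?mulr0 ?addr0// => ?; apply: KLx; [by right|by left].
- apply: (admissible_lin mU mp p1 mu1 mv1 mw1 lu lv _ e0 ae be) => x _.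
  have -> : a * u x + b * v x - (a * u' x + b * v' x) =
      a * (u x - u' x) + b * (v x - v' x) by ring.
  by rewrite (le_trans (ler_normD _ _))// !normrM.
- apply: (admissible_lin mU mp p1 mG1 mH1 mw2 lG lH _ e0 ae be) => x _.
  rewrite !(ger0_norm (enorm_ge0 _)).
  have -> : a *: grad U u x + b *: grad U v x - (a *: G' x + b *: H' x) =
      a *: (grad U u x - G' x) - (- b) *: (grad U v x - H' x).
    by apply/rowP => i; rewrite !mxE; ring.
  by rewrite (le_trans (enorm_triangle _ _))// !enormZ normrN.
Qed.

Lemma W1p0B u v : W1p0 U p u -> W1p0 U p v -> W1p0 U p (fun x => u x - v x).
Proof.
move=> u0 v0; have := W1p0_lin 1 (-1) u0 v0.
by congr W1p0; apply/funext => x; rewrite mul1r mulN1r.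
Qed.

End SobolevSpaces.

(** * Extension by zero *)
Section ExtensionByZero.
Context {R : realType} {N : nat} (N0 : (0 < N)%N).
Local Notation mu := (@lebesgue_rV R N).
Context (D U : set 'rV[R]_N) (p : 'rV[R]_N -> R).
Context (Do : open D) (Db : bounded_set D) (pD : variable_exponent D p).
Context (Uo : open U) (UD : U `<=` D).
Implicit Types (f g h u v w phi psi : 'rV[R]_N -> R) (G H : 'rV[R]_N -> 'rV[R]_N).

Let mD : measurable D := open_rV_measurable N0 Do.
Let mU : measurable U := open_rV_measurable N0 Uo.

Lemma variable_exponent_sub : variable_exponent U p.
Proof.
case: pD => mp p1 [M pM]; split; first exact: measurable_funS mp.
  by move=> x /UD /p1.
by exists M => x /UD /pM.
Qed.

Lemma bounded_set_sub : bounded_set U.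
Proof.
have [M [Mr h]] := Db; exists M; split => // x Mx y /UD; exact: h.
Qed.

Let pU := variable_exponent_sub.
Let Ub := bounded_set_sub.

Definition extend0_field G : 'rV[R]_N -> 'rV[R]_N := patch (fun=> 0) U G.

Lemma extend0_in u x : U x -> extend0 U u x = u x.
Proof. by move=> Ux; rewrite /extend0 /patch mem_set. Qed.

Lemma extend0_out u x : ~ U x -> extend0 U u x = 0.
Proof. by move=> Ux; rewrite /extend0 /patch memNset. Qed.

Lemma extend0_field_in G x : U x -> extend0_field G x = G x.
Proof. by move=> Ux; rewrite /extend0_field /patch mem_set. Qed.

Lemma extend0_field_out G x : ~ U x -> extend0_field G x = 0.
Proof. by move=> Ux; rewrite /extend0_field /patch memNset. Qed.

Lemma measurable_extend0 u : measurable_fun U u -> measurable_fun D (extend0 U u).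
Proof.
move=> mu_; have := (measurable_restrict u mU mD).1.
rewrite setIidr// => /(_ mu_); apply: eq_measurable_fun => x _.
by rewrite /extend0 /patch.
Qed.

Lemma modular_extend0 u : modular D p (extend0 U u) = modular U p u.
Proof.
rewrite /modular -{2}(setIidr UD) integral_mkcondr; apply: eq_integral => x.
rewrite inE => Dx; rewrite /extend0 /patch; case: ifPn => // _.
rewrite normr0 powR0//; case: pD => _ p1 _.
by rewrite gt_eqF// (lt_le_trans _ (p1 x Dx)).
Qed.

Lemma admissible_extend0 u l : admissible D p (extend0 U u) l = admissible U p u l.
Proof.
rewrite /admissible /mkset -(modular_extend0 (fun x => u x / l)).
have -> // : (fun x => extend0 U u x / l) = extend0 U (fun x => u x / l).
by apply/funext => x; rewrite /extend0 /patch; case: ifP => // _; rewrite mul0r.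
Qed.

Lemma finite_modular_extend0 u : finite_modular U p u ->
  finite_modular D p (extend0 U u).
Proof.
by move=> [mu_ fu]; split; [exact: measurable_extend0|rewrite modular_extend0].
Qed.

Lemma enorm_extend0_field G :
  (fun x => enorm (extend0_field G x)) = extend0 U (fun x => enorm (G x)).
Proof.
apply/funext => x; rewrite /extend0_field /extend0 /patch.
by case: ifP => // _; rewrite enorm0.
Qed.

(** If eta is a cutoff for the support K of v, then eta phi is a test function of
    U.  It may be replaced by phi on both sides: eta = 1 near K, hence the
    derivative of eta vanishes on K, and v and its gradient vanish off K. *)
Lemma compact_support_by_parts v H phi i : weak_gradient U v H ->
  supported_in U v -> test_function D phi ->
  \int[mu]_(x in U) (v x * partial i phi x) =
  - \int[mu]_(x in U) (H x 0 i * phi x).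
Proof.
move=> vH [K [Kc KU vK]] phit; have [phiC _ _] := phit.
have [eta [etaC [K' [K'c K'U eta0]] [V [Vo KV eta1]]]] := smooth_cutoff Uo Kc KU.
have et : test_function U (fun x => eta x * phi x).
  split; first by move=> k; exact: CkM.
    by exists K'; split => // x _ /eta0 ->; rewrite mul0r.
  by move=> x Ux; rewrite eta0 ?mul0r// => /K'U.
have [vL HL vHp] := vH; have := vHp _ i et.
have Co : open (U `&` ~` K).
  by apply: openI => //; apply: closed_openC; exact: compact_closed.
have H0 : {ae mu, forall x, (U `&` ~` K) x -> H x = 0}.
  by apply: (weak_gradient_local N0 Uo Co _ vH) => [x []//|x [Ux Kx]]; exact: vK.
have -> : \int[mu]_(x in U) (v x * partial i (fun x => eta x * phi x) x) =
    \int[mu]_(x in U) (v x * partial i phi x).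
  apply: eq_Rintegral => x; rewrite inE => Ux.
  have [Kx|Kx] := pselect (K x); last by rewrite vK ?mul0r.
  have Vx := KV x Kx.
  have [_ de] := etaC 1%N; have [/(_ x) dex _] := de i.
  have [_ dp] := phiC 1%N; have [/(_ x) dpx _] := dp i.
  rewrite partialM// (partial_near_cst i Vo Vx eta1) eta1//.
  by rewrite mulr0 addr0 mul1r.
move=> ->; congr (- _); congr fine.
have mH : measurable_fun U (fun x => H x 0 i) by case: (HL i).
have mc k f : Ck k f -> measurable_fun U f.
  move=> /Ck_continuous/(continuous_rV_measurable N0); exact: measurable_funS.
apply: ae_eq_integral => //.
- apply/measurable_EFinP; apply: measurable_funM => //.
  by apply: measurable_funM; [exact: mc 0%N _ (etaC _)|exact: mc 0%N _ (phiC _)].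
- by apply/measurable_EFinP; apply: measurable_funM => //; exact: mc 0%N _ (phiC _).
- apply: filterS H0 => x hx Ux; have [Kx|Kx] := pselect (K x).
    by rewrite eta1 ?mul1r//; exact: KV.
  by rewrite hx ?mxE ?mul0r.
Qed.

Lemma integrable_mul_bounded g psi (C : R) : finite_modular U p g ->
  measurable_fun U psi -> (forall x, `|psi x| <= C) ->
  mu.-integrable U (EFin \o (fun x => g x * psi x)).
Proof.
move=> fg mpsi psiC; have gi := finite_modular_integrable N0 Uo Ub pU fg.
have h : mu.-integrable U (fun x => C%:E * (`|g x|)%:E)%E.
  by apply: integrableZl => //; exact: integrable_norm gi.
apply: le_integrable h => //.
  by apply/measurable_EFinP; apply: measurable_funM => //; case: fg.
move=> x _; rewrite /= !normrM normr_id lee_fin mulrC.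
by rewrite ler_wpM2r// (le_trans (psiC x))// ler_norm.
Qed.

Lemma Rintegral_mul_bounded g psi (C l : R) : finite_modular U p g ->
  measurable_fun U psi -> (forall x, `|psi x| <= C) -> 0 <= C -> admissible U p g l ->
  `|\int[mu]_(x in U) (g x * psi x)| <= C * (l * (fine (mu U) + 1)).
Proof.
move=> fg mpsi psiC C0 gl; have [mg _] := fg.
have gi := finite_modular_integrable N0 Uo Ub pU fg.
have gpi := integrable_mul_bounded fg mpsi psiC.
have [mp p1 _] := pU.
apply: (le_trans (le_normr_Rintegral mU gpi)).
apply: (@le_trans _ _ (\int[mu]_(x in U) (C * `|g x|))).
  apply: le_Rintegral => //.
  - exact: integrable_norm gpi.
  - by apply: eq_integrable (integrableZl mU C (integrable_norm gi)) => // x _; rewrite /= EFinM.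
  - by move=> x _; rewrite normrM mulrC ler_wpM2r.
rewrite RintegralZl//; last exact: integrable_norm gi.
rewrite ler_wpM2l// -lee_fin.
have muU : (mu U < +oo)%E by apply: bounded_lebesgue_lty.
have fU : mu U \is a fin_num by rewrite ge0_fin_numE.
rewrite /Rintegral fineK; last first.
  by apply: integrable_fin_num => //; exact: integrable_norm gi.
by rewrite EFinM EFinD fineK//; exact: admissible_integral_le gl.
Qed.

(** Approximating u by v with compact support changes both sides of the identity
    by at most a multiple of the distance of u to v in the L^1 norm. *)
Lemma weak_gradient_extend0 u G : W1p0 U p u -> sobolev U p u G ->
  weak_gradient D (extend0 U u) (extend0_field G).
Proof.
move=> u0 uG; have [uwG fu fG] := uG.
have mG := weak_gradient_measurable uwG.
have fGi i : finite_modular U p (fun x => G x 0 i).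
  exact: finite_modular_coord (mG i) fG.
have ei G' i : (fun x => extend0_field G' x 0 i) = extend0 U (fun x => G' x 0 i).
  apply/funext => x; have [Ux|Ux] := pselect (U x).
    by rewrite extend0_field_in// extend0_in.
  by rewrite extend0_field_out// extend0_out// mxE.
split.
- by have [] := (LpP N0 Do Db pD _).2 (finite_modular_extend0 fu).
- by move=> i; rewrite ei; have [] := (LpP N0 Do Db pD _).2 (finite_modular_extend0 (fGi i)).
move=> phi i phit.
have eI f g : \int[mu]_(x in D) (extend0 U f x * g x) = \int[mu]_(x in U) (f x * g x).
  rewrite -{2}(setIidr UD) Rintegral_mkcondr; apply: eq_Rintegral => x _.
  by rewrite /extend0 /patch; case: ifP => // _; rewrite mul0r.
have eG : \int[mu]_(x in D) (extend0_field G x 0 i * phi x) =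
    \int[mu]_(x in U) (G x 0 i * phi x).
  by rewrite -eI; apply: eq_Rintegral => x _; rewrite (congr1 (@^~ x) (ei G i)).
rewrite eI eG.
have [C C0 CP] := test_function_bounded phit.
have [phiC _ _] := phit.
have mphi : measurable_fun U phi.
  by apply: measurable_funS (continuous_rV_measurable N0 (Ck_continuous (phiC 0%N))).
have mdphi : measurable_fun U (partial i phi).
  have [_ /(_ i)[_ dc]] := phiC 1%N.
  by apply: measurable_funS (continuous_rV_measurable N0 (Ck_continuous (k := 0%N) dc)).
have bphi x : `|phi x| <= C by have [] := CP x.
have bdphi x : `|partial i phi x| <= C by have [_] := CP x.
apply/eqP; rewrite -subr_eq0 opprK -normr_le0; apply/ler_addgt0Pr => e e0.
rewrite add0r.
have f0 : 0 <= fine (mu U) by rewrite fine_ge0// measure_ge0.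
pose k := 2 * (C + 1) * (fine (mu U) + 1).
have k0 : 0 < k by rewrite /k !mulr_gt0//; lra.
have d0 : 0 < e / k by rewrite divr_gt0.
have [v [H [vH vs lv lH]]] := (W1p0P N0 Uo Ub pU uG).1 u0 _ d0.
have [vwH fv fH] := vH.
have mH := weak_gradient_measurable vwH.
have fHi : finite_modular U p (fun x => H x 0 i).
  exact: finite_modular_coord (mH i) fH.
have vp := compact_support_by_parts i vwH vs phit.
have fuv : finite_modular U p (fun x => u x - v x).
  apply: (finite_modular_lin (a := 1) (b := -1) N0 Uo pU fu fv).
    by apply: measurable_funB; [case: fu|case: fv].
  by move=> x _; rewrite normrN !normr1 !mul1r ler_normB.
have fGH : finite_modular U p (fun x => G x 0 i - H x 0 i).
  apply: (finite_modular_lin (a := 1) (b := -1) N0 Uo pU (fGi i) fHi).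
    by apply: measurable_funB.
  by move=> x _; rewrite normrN !normr1 !mul1r ler_normB.
have [mp p1 _] := pU.
have lGH : admissible U p (fun x => G x 0 i - H x 0 i) (e / k).
  have [l0 l1] := lH; split; [exact: l0|apply: le_lt_trans l1].
  apply: modular_le => //.
  - by apply: measurable_funM => //; case: fGH.
  - apply: measurable_funM => //; apply: measurable_enorm => j.
    by under eq_fun do rewrite !mxE; exact: measurable_funB.
  - move=> x _; rewrite !normrM ler_wpM2r// (ger0_norm (enorm_ge0 _)).
    by have := abs_coord_le_enorm (G x - H x) i; rewrite !mxE.
have b1 := Rintegral_mul_bounded fuv mdphi bdphi C0 lv.
have b2 := Rintegral_mul_bounded fGH mphi bphi C0 lGH.
have -> : \int[mu]_(x in U) (u x * partial i phi x) + \int[mu]_(x in U) (G x 0 i * phi x) =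
    \int[mu]_(x in U) ((u x - v x) * partial i phi x) +
    \int[mu]_(x in U) ((G x 0 i - H x 0 i) * phi x).
  have E f g h C' : finite_modular U p f -> finite_modular U p g ->
      measurable_fun U h -> (forall x, `|h x| <= C') ->
      \int[mu]_(x in U) ((f x - g x) * h x) =
      \int[mu]_(x in U) (f x * h x) - \int[mu]_(x in U) (g x * h x).
    move=> ff gg mh hC; rewrite -RintegralB//; try exact: integrable_mul_bounded hC.
    by apply: eq_Rintegral => x _; rewrite mulrBl.
  rewrite (E _ _ _ C fu fv mdphi bdphi) (E _ _ _ C (fGi i) fHi mphi bphi) vp.
  ring.
apply: (le_trans (ler_normD _ _)); apply: (le_trans (lerD b1 b2)).
have -> : C * (e / k * (fine (mu U) + 1)) + C * (e / k * (fine (mu U) + 1)) =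
   e * (2 * C * (fine (mu U) + 1) / k) by field; rewrite gt_eqF.
rewrite ler_piMr ?(ltW e0)// ler_pdivrMr// mul1r /k ler_wpM2r//; lra.
Qed.

Lemma sobolev_extend0 u G : W1p0 U p u -> sobolev U p u G ->
  sobolev D p (extend0 U u) (extend0_field G).
Proof.
move=> u0 uG; have [_ fu fG] := uG; split; first exact: weak_gradient_extend0.
  exact: finite_modular_extend0.
by rewrite enorm_extend0_field; exact: finite_modular_extend0.
Qed.

Lemma W1p0_extend0 u : W1p0 U p u -> W1p0 D p (extend0 U u).
Proof.
move=> u0; have [uW _] := u0; have uG := W1p_sobolev N0 Uo Ub pU uW.
apply/(W1p0P N0 Do Db pD (sobolev_extend0 u0 uG)) => e e0.
have [v [H [vH vs lv lH]]] := (W1p0P N0 Uo Ub pU uG).1 u0 _ e0.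
have v0 : W1p0 U p v.
  have admissible0 d : 0 < d -> admissible U p (fun=> 0) d.
    move=> d0; split; first exact: d0.
    rewrite /modular (eq_integral (cst 0%E)) ?integral0// => x; rewrite inE => Ux.
    rewrite mul0r normr0 powR0//; case: pU => _ p1 _.
    by rewrite gt_eqF// (lt_le_trans _ (p1 x Ux)).
  apply/(W1p0P N0 Uo Ub pU vH) => d d0; exists v, H.
  split; [exact: vH|exact: vs| |].
    by under eq_fun do rewrite subrr; exact: admissible0.
  by under eq_fun do rewrite subrr enorm0; exact: admissible0.
exists (extend0 U v), (extend0_field H); split.
- exact: sobolev_extend0.
- have [K [Kc KU vK]] := vs; exists K; split => //; first exact: subset_trans UD.
  move=> x _ Kx; have [Ux|Ux] := pselect (U x); last by rewrite extend0_out.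
  by rewrite extend0_in// vK.
- rewrite (_ : (fun x => _) = extend0 U (fun x => u x - v x)); first by rewrite admissible_extend0.
  by apply/funext => x; rewrite /extend0 /patch; case: ifP; rewrite ?subrr.
- rewrite (_ : (fun x => _) = extend0 U (fun x => enorm (grad U u x - H x))).
    by rewrite admissible_extend0.
  by apply/funext => x; rewrite /extend0 /extend0_field /patch; case: ifP; rewrite ?subrr ?enorm0.
Qed.

End ExtensionByZero.

(** * The dual norm *)
Section DualNorm.
Context {R : realType} {N : nat} (N0 : (0 < N)%N).
Context (D : set 'rV[R]_N) (p : 'rV[R]_N -> R).
Context (Do : open D) (Db : bounded_set D) (pD : variable_exponent D p).
Implicit Types (f : ('rV[R]_N -> R) -> R) (w : 'rV[R]_N -> R).

(** By homogeneity; with admissible scales l instead of the norm there is no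
    separate case for functions with zero gradient. *)
Lemma dual_le f w G l : W1p0_dual D p f -> W1p0 D p w -> sobolev D p w G ->
  admissible D p (fun x => enorm (G x)) l -> f w <= dual_norm D p f * l.
Proof.
move=> [flin [c fc]] w0 wG Gl; have l0 := admissible_gt0 Gl.
pose W x := l^-1 * w x + 0 * w x.
have W0 : W1p0 D p W := W1p0_lin N0 Do Db pD l^-1 0 w0 w0.
have WG := sobolev_lin N0 Do pD l^-1 0 wG wG.
have W1 : grad_norm D p W <= 1.
  have -> := sobolev_grad_norm N0 Do pD WG.
  apply: Lp_norm_le; split => //; case: Gl => _.
  rewrite (_ : (fun x => enorm (G x) / l) =
    (fun x => enorm (l^-1 *: G x + 0 *: G x) / 1))//.
  apply/funext => x; rewrite scale0r addr0 enormZ divr1 mulrC ger0_norm//.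
  by rewrite invr_ge0 ltW.
have : f W <= dual_norm D p f.
  apply: ub_le_sup; last by exists W.
  exists `|c| => _ [u [u0 u1] <-]; apply: (le_trans (ler_norm _)).
  apply: (le_trans (fc u u0)); apply: (@le_trans _ _ (`|c| * grad_norm D p u)).
    by apply: ler_wpM2r; [exact: Lp_norm_ge0|exact: ler_norm].
  by rewrite ler_piMr.
by rewrite flin// mul0r addr0 mulrC ler_pdivrMr.
Qed.

Lemma W1p0_dualB f1 f2 : W1p0_dual D p f1 -> W1p0_dual D p f2 ->
  W1p0_dual D p (f1 \- f2).
Proof.
move=> [l1 [c1 b1]] [l2 [c2 b2]]; split.
  by move=> a b u v u0 v0; rewrite /= l1// l2//; ring.
exists (c1 + c2) => u u0; rewrite /= mulrDl (le_trans (ler_normB _ _))//.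
by rewrite lerD ?b1 ?b2.
Qed.

Lemma dual_norm_ge0 f w : W1p0_dual D p f -> W1p0 D p w -> 0 <= dual_norm D p f.
Proof.
move=> fD w0; have [wW _] := w0.
have wG := W1p_sobolev N0 Do Db pD wW; have [_ _ [mG fG]] := wG.
have [mp p1 _] := pD.
have [l gl] := admissible_neq0 (open_rV_measurable N0 Do) mp p1 mG fG.
have l0 := admissible_gt0 gl.
have h1 := dual_le fD w0 wG gl.
have nG := sobolev_lin N0 Do pD (-1) 0 wG wG.
have nw0 := W1p0_lin N0 Do Db pD (-1) 0 w0 w0.
have gl' : admissible D p (fun x => enorm (-1 *: grad D w x + 0 *: grad D w x)) l.
  have -> // : (fun x => enorm (-1 *: grad D w x + 0 *: grad D w x)) =
      (fun x => enorm (grad D w x)).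
  by apply/funext => x; rewrite scale0r addr0 enormZ normrN1 mul1r.
have := dual_le fD nw0 nG gl'.
have [flin _] := fD; rewrite flin// mul0r addr0 => h2.
by rewrite -(pmulr_lge0 _ l0); lra.
Qed.

End DualNorm.

(** * Stability of weak solutions *)
(** The positive solution of k^pm = 2 M k, plus 1: the bound for the norm of grad u
    that results from data of norm M. *)
Definition gradient_bound {R : realType} (pm M : R) : R :=
  1 + (2 * M) `^ (pm - 1)^-1.

Section WeakSolutions.
Context {R : realType} {N : nat} (N0 : (0 < N)%N).
Local Notation mu := (@lebesgue_rV R N).
Context (D U : set 'rV[R]_N) (p : 'rV[R]_N -> R).
Context (Do : open D) (Db : bounded_set D) (pD : variable_exponent D p).
Context (Uo : open U) (UD : U `<=` D).
Implicit Types (u v : 'rV[R]_N -> R) (G H : 'rV[R]_N -> 'rV[R]_N).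
Implicit Types (f : ('rV[R]_N -> R) -> R).

Let mU : measurable U := open_rV_measurable N0 Uo.
Let pU : variable_exponent U p := variable_exponent_sub N0 Do pD UD.
Let Ub : bounded_set U := bounded_set_sub Db UD.

(** The integrand of the weak formulation. *)
Definition flux G H x : R := enorm (G x) `^ (p x - 2) * dotp (G x) (H x).

Lemma flux_le G H x : 1 <= p x ->
  `|flux G H x| <= enorm (G x) `^ p x + enorm (H x) `^ p x.
Proof.
move=> px; rewrite /flux; set a := enorm (G x); set b := enorm (H x).
have a0 : 0 <= a by exact: enorm_ge0.
have b0 : 0 <= b by exact: enorm_ge0.
rewrite normrM (ger0_norm (powR_ge0 _ _)).
apply: (@le_trans _ _ (a `^ (p x - 2) * (a * b))).
  by rewrite ler_wpM2l ?powR_ge0// dotp_norm_le.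
have [->|an0] := eqVneq a 0; first by rewrite mul0r mulr0 addr_ge0// powR_ge0.
have ap : 0 < a by rewrite lt_neqAle eq_sym an0.
have E : a `^ (p x - 2) * a = a `^ (p x - 1).
  rewrite -{2}(powRr1 a0) -powRD; first by congr (_ `^ _); ring.
  by rewrite an0 implybT.
rewrite mulrA E; have [ba|ab] := leP b a.
  apply: (@le_trans _ _ (a `^ (p x - 1) * a)); first by rewrite ler_wpM2l ?powR_ge0.
  by rewrite mulrC mulr_powRB1 ?lerDl ?powR_ge0//; lra.
apply: (@le_trans _ _ (b `^ (p x - 1) * b)).
  by rewrite ler_wpM2r// ge0_ler_powR ?nnegrE ?(ltW ab)// subr_ge0.
by rewrite mulrC mulr_powRB1 ?lerDr ?powR_ge0//; lra.
Qed.

Lemma integrable_enorm_powR u G : sobolev U p u G ->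
  mu.-integrable U (fun x => (enorm (G x) `^ p x)%:E).
Proof.
move=> [_ _ [mG fG]]; have [mp p1 _] := pU.
apply/integrableP; split.
  by apply/measurable_EFinP; exact: measurable_powR_fun.
apply: le_lt_trans fG; rewrite le_eqVlt; apply/orP; left; apply/eqP.
apply: eq_integral => x _; rewrite /= ger0_norm ?powR_ge0//.
by rewrite (ger0_norm (enorm_ge0 _)).
Qed.

Lemma integrable_flux u v G H : sobolev U p u G -> sobolev U p v H ->
  mu.-integrable U (EFin \o flux G H).
Proof.
move=> uG vH; have [wG _ [mG _]] := uG; have [wH _ _] := vH.
have [mp p1 _] := pU.
have h := integrableD mU (integrable_enorm_powR uG) (integrable_enorm_powR vH).
apply: le_integrable h => //.
  apply/measurable_EFinP; apply: measurable_funM.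
    by apply: measurable_powR_fun => //; exact: measurable_funB.
  apply: measurable_sum => i.
  by apply: measurable_funM; [exact: weak_gradient_measurable wG i|exact: weak_gradient_measurable wH i].
move=> x Ux; rewrite /= lee_fin.
rewrite (ger0_norm (addr_ge0 (powR_ge0 _ _) (powR_ge0 _ _))).
exact: flux_le (p1 x Ux).
Qed.

Lemma weak_solution_test f u v H : weak_solution U p f u ->
  W1p0 U p v -> sobolev U p v H ->
  \int[mu]_(x in U) flux (grad U u) H x = f (extend0 U v).
Proof.
move=> [u0 uE] v0 vH; have [uW _] := u0; have [vW _] := v0.
have uG := W1p_sobolev N0 Uo Ub pU uW; have vG := W1p_sobolev N0 Uo Ub pU vW.
rewrite -uE// /Rintegral; congr fine; apply: ae_eq_integral => //.
- exact: measurable_int (integrable_flux uG vH).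
- exact: measurable_int (integrable_flux uG vG).
- have [wH _ _] := vH; apply: filterS (grad_ae N0 Uo wH) => x h Ux.
  by rewrite /flux h.
Qed.

(** Testing with u itself bounds the modular r of grad u by M times any admissible
    scale.  Conversely, a scale l >= 1 with l^pm >= 2 r is admissible; the smallest
    one is 1 or satisfies l^pm = 2 r <= 2 M l, which bounds l because pm > 1. *)
Lemma a_priori_bound f u (pm M : R) : W1p0_dual D p f -> weak_solution U p f u ->
  1 < pm -> (forall x, U x -> pm <= p x) -> dual_norm D p f <= M -> 0 <= M ->
  admissible U p (fun x => enorm (grad U u x)) (gradient_bound pm M) /\
  \int[mu]_(x in U) (enorm (grad U u x) `^ p x) <= M * gradient_bound pm M.
Proof.
move=> fD us pm1 pmp fM M0; set k := gradient_bound pm M; have [u0 _] := us; have [uW _] := u0.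
have uG := W1p_sobolev N0 Uo Ub pU uW; have [_ _ [mG fG]] := uG.
have [mp p1 _] := pU.
set a := fun x => enorm (grad U u x).
set r := \int[mu]_(x in U) _.
have r0 : 0 <= r by apply: Rintegral_ge0 => x _; exact: powR_ge0.
have rE : modular U p a = r%:E.
  rewrite /r /Rintegral fineK; last by apply: integrable_fin_num => //; exact: integrable_enorm_powR uG.
  by apply: eq_integral => x _; rewrite (ger0_norm (enorm_ge0 _)).
have rM l : admissible U p a l -> r <= M * l.
  move=> al; have l0 := admissible_gt0 al.
  have -> : r = f (extend0 U u).
    rewrite -(weak_solution_test us u0 uG); apply: eq_Rintegral => x; rewrite inE => Ux.
    rewrite /flux -sqr_enorm -powR_mulrn ?enorm_ge0//.
    have [->|n0] := eqVneq (enorm (grad U u x)) 0.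
      by rewrite (powR0 (x := 2)) ?mulr0 ?powR0// gt_eqF// (lt_le_trans ltr01)// p1.
    by rewrite -powRD ?n0 ?implybT// subrK.
  apply: (@le_trans _ _ (dual_norm D p f * l)); last by rewrite ler_wpM2r// ltW.
  apply: (dual_le N0 Do Db pD fD (W1p0_extend0 N0 Do Db pD Uo UD u0)
    (sobolev_extend0 N0 Do Db pD Uo UD u0 uG)).
  by rewrite enorm_extend0_field admissible_extend0.
pose c := (2 * r) `^ pm^-1; pose l := Num.max 1 c.
have pm0 : 0 < pm by lra.
have l1 : 1 <= l by rewrite le_max lexx.
have l0 : 0 < l by lra.
have cpm : c `^ pm = 2 * r.
  by rewrite /c -powRrM mulVf ?gt_eqF// powRr1// mulr_ge0.
have c0 : 0 <= c by exact: powR_ge0.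
have lpm : 2 * r <= l `^ pm.
  by rewrite -cpm ge0_ler_powR ?nnegrE ?(ltW pm0)// ?(ltW l0)// le_max lexx orbT.
have al : admissible U p a l.
  split=> //; under eq_fun do rewrite mulrC.
  have l01 : 0 < l^-1 <= 1 by rewrite invr_gt0 l0 invf_le1.
  apply: (le_lt_trans (modular_scale_le1 mU mp mG pmp l01)).
  rewrite rE -EFinM lte_fin -powR_inv1 ?(ltW l0)// -powRrM mulN1r powRN.
  rewrite mulrC ltr_pdivrMr ?powR_gt0// mul1r.
  have : 1 <= l `^ pm by rewrite -(powRr0 l) ler_powR// ltW.
  lra.
have lk : l <= k.
  rewrite ge_max /k /gradient_bound lerDl powR_ge0/=.
  have [c1|c1] := leP c 1; first by rewrite ler_wpDr// powR_ge0.
  rewrite ler_wpDl//; have cp : 0 < c by lra.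
  have lc : l = c by rewrite /l; apply/max_idPr; exact: ltW.
  have := rM _ al; rewrite lc => rc.
  have cc : c * c `^ (pm - 1) <= c * (2 * M).
    by rewrite mulr_powRB1 ?(ltW cp)// cpm; lra.
  rewrite ler_pM2l// in cc.
  have -> : c = (c `^ (pm - 1)) `^ (pm - 1)^-1.
    by rewrite -powRrM divff ?powRr1// gt_eqF// subr_gt0.
  by rewrite ge0_ler_powR ?nnegrE ?powR_ge0 ?mulr_ge0// invr_ge0 subr_ge0 ltW.
have ak : admissible U p a k by apply: admissible_le al lk.
by split => //; exact: rM.
Qed.

(** The pointwise inequality integrated: the gap is controlled by the difference of
    the equations tested with u1 - u2, and the modulars of the two gradients by
    the a priori bound. *)
Lemma stability_estimate f1 f2 u1 u2 (pm pp M s : R) :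
  W1p0_dual D p f1 -> W1p0_dual D p f2 ->
  weak_solution U p f1 u1 -> weak_solution U p f2 u2 ->
  1 < pm -> (forall x, U x -> pm <= p x <= pp) ->
  dual_norm D p f1 <= M -> dual_norm D p f2 <= M -> 0 <= M -> 0 < s <= 1 ->
  (modular U p (fun x => enorm (grad U u1 x - grad U u2 x)) <=
   (2 `^ pp * (2 / Num.min 1 (pm - 1)) / s *
      (dual_norm D p (f1 \- f2) * (4 * gradient_bound pm M))
    + s * (M * gradient_bound pm M + M * gradient_bound pm M))%:E)%E.
Proof.
move=> f1D f2D us1 us2 pm1 pmpp f1M f2M M0 s01; set k := gradient_bound pm M.
pose G x := grad U u1 x - grad U u2 x.
have pmp x : U x -> pm <= p x by move=> /pmpp/andP[].
have [[u10 _] [u20 _]] := (us1, us2); have [[u1W _] [u2W _]] := (u10, u20).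
have uG1 := W1p_sobolev N0 Uo Ub pU u1W; have uG2 := W1p_sobolev N0 Uo Ub pU u2W.
have [l1 r1] := a_priori_bound f1D us1 pm1 pmp f1M M0.
have [l2 r2] := a_priori_bound f2D us2 pm1 pmp f2M M0.
have v0 := W1p0B N0 Uo Ub pU u10 u20.
have vG : sobolev U p _ G := sobolevB N0 Uo pU uG1 uG2.
have [mp p1 _] := pU.
have [_ _ [m1 _]] := uG1; have [_ _ [m2 _]] := uG2; have [_ _ [mG fG]] := vG.
have k0 : 0 < k by rewrite /k /gradient_bound ltr_pwDl// powR_ge0.
have lG : admissible U p (fun x => enorm (G x)) (4 * k).
  apply: (admissible_lin (a := 1) (b := -1) mU mp p1 m1 m2 mG l1 l2).
  - move=> x _; rewrite !(ger0_norm (enorm_ge0 _)) normrN !normr1 !mul1r.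
    exact: enorm_triangle.
  - by rewrite mulr_gt0.
  - by rewrite normr1 mul1r.
  - by rewrite normrN normr1 mul1r.
have gapE : \int[mu]_(x in U) (1 * flux (grad U u1) G x + (-1) * flux (grad U u2) G x)
    <= dual_norm D p (f1 \- f2) * (4 * k).
  rewrite (Rintegral_lin 1 (-1) mU (integrable_flux uG1 vG) (integrable_flux uG2 vG)).
  rewrite (weak_solution_test us1 v0 vG) (weak_solution_test us2 v0 vG).
  rewrite mul1r mulN1r.
  apply: (dual_le N0 Do Db pD (W1p0_dualB f1D f2D) (W1p0_extend0 N0 Do Db pD Uo UD v0)
    (sobolev_extend0 N0 Do Db pD Uo UD v0 vG)).
  by rewrite enorm_extend0_field admissible_extend0.
set c := 2 `^ pp * _ / s; have cE : c = 2 `^ pp * (2 / Num.min 1 (pm - 1)) / s by [].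
clearbody c; have c0 : 0 <= c.
  have [s0 _] := andP s01; rewrite cE !mulr_ge0 ?powR_ge0 ?invr_ge0 ?(ltW s0)//.
  by rewrite le_min ler01 subr_ge0 ltW.
have i1 := integrable_enorm_powR uG1; have i2 := integrable_enorm_powR uG2.
have iF := integrable_lin 1 (-1) mU (integrable_flux uG1 vG) (integrable_flux uG2 vG).
have iP := integrable_lin 1 1 mU i1 i2.
have iG := integrable_enorm_powR vG.
have -> : modular U p (fun x => enorm (G x)) =
    (\int[mu]_(x in U) (enorm (G x) `^ p x))%:E.
  rewrite /Rintegral fineK; last exact: integrable_fin_num.
  by apply: eq_integral => x _; rewrite (ger0_norm (enorm_ge0 _)).
have aux (y g g1 g2 q1 q2 : R) : 1 * g1 + (-1) * g2 = g ->
    y <= c * g + s * (q1 + q2) ->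
    y <= c * (1 * g1 + (-1) * g2) + s * (1 * q1 + 1 * q2).
  by move=> -> h; rewrite !mul1r.
rewrite lee_fin; apply: (@le_trans _ _ (\int[mu]_(x in U)
  (c * (1 * flux (grad U u1) G x + (-1) * flux (grad U u2) G x)
   + s * (1 * enorm (grad U u1 x) `^ p x + 1 * enorm (grad U u2 x) `^ p x)))).
  apply: (le_Rintegral mU iG (integrable_lin c s mU iF iP)) => x Ux.
  have /andP[pmx ppx] := pmpp x Ux.
  have h := enormB_powR_le_gap (grad U u1 x) (grad U u2 x) pm1 pmx ppx s01.
  rewrite -cE in h.
  have gE : 1 * flux (grad U u1) G x + (-1) * flux (grad U u2) G x =
      monotonicity_gap (p x) (grad U u1 x) (grad U u2 x).
    by rewrite /flux /monotonicity_gap /G !dotpBr mul1r mulN1r.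
  exact: aux gE h.
rewrite (Rintegral_lin c s mU iF iP); apply: lerD; first by rewrite ler_wpM2l.
have [s0 _] := andP s01; apply: ler_wpM2l; first exact: ltW.
have aux2 (y1 y2 z1 z2 : R) : y1 <= z1 -> y2 <= z2 -> 1 * y1 + 1 * y2 <= z1 + z2.
  by move=> h1 h2; rewrite !mul1r lerD.
by rewrite (Rintegral_lin 1 1 mU i1 i2); exact: aux2 r1 r2.
Qed.

End WeakSolutions.

(** With s = min(1, sqrt d), or s -> 0 if d = 0. *)
Lemma optimize_scale {R : realType} (X A B d : R) : 0 <= A -> 0 <= B -> 0 <= d ->
  (forall s, 0 < s <= 1 -> X <= A / s * d + s * B) ->
  X <= (A + B + 1) * (d + d `^ 2^-1).
Proof.
move=> A0 B0 d0 h; have [d00|dn0] := eqVneq d 0.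
  rewrite d00 powR0 ?invr_neq0// addr0 mulr0; apply/ler_addgt0Pr => e e0.
  (* This s makes the remaining term s * B smaller than e. *)
  rewrite add0r; have eB : 0 < e / (B + e) by rewrite divr_gt0// ltr_wpDl.
  have eB1 : e / (B + e) <= 1 by rewrite ler_pdivrMr ?ltr_wpDl// mul1r lerDr.
  have := h (e / (B + e)); rewrite eB eB1 => /(_ isT).
  rewrite d00 mulr0 add0r => /le_trans; apply.
  rewrite -mulrA ler_piMr ?(ltW e0)// mulrC ler_pdivrMr ?ltr_wpDl// mul1r lerDl.
  exact: ltW.
have dp : 0 < d by rewrite lt_neqAle eq_sym dn0.
have sq0 : 0 < d `^ 2^-1 by rewrite powR_gt0.
have [d1|d1] := leP d 1; last first.
  have := h 1; rewrite ltr01 lexx => /(_ isT); rewrite divr1 mul1r => hX.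
  have BD : B <= B * d by rewrite ler_peMr// ltW.
  have : 0 <= (A + B + 1) * d `^ 2^-1 by rewrite mulr_ge0 ?(ltW sq0)// !addr_ge0.
  rewrite mulrDr mulrDl mulrDl; lra.
have sq1 : d `^ 2^-1 <= 1.
  have e1 : (1 : R) `^ 2^-1 = 1 by rewrite powR1.
  by rewrite -[leRHS]e1 ge0_ler_powR ?nnegrE// invr_ge0.
have dE : d = d `^ 2^-1 * d `^ 2^-1.
  by rewrite -powRD ?dn0 ?implybT// -[in LHS](powRr1 d0); congr (_ `^ _); field.
have := h (d `^ 2^-1); rewrite sq0 sq1 => /(_ isT).
have -> : A / d `^ 2^-1 * d = A * d `^ 2^-1.
  by rewrite {2}dE; field; rewrite gt_eqF.
move=> hX; have : 0 <= (A + B + 1) * d by rewrite mulr_ge0// !addr_ge0.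
by rewrite mulrDr; have := ltW sq0; lra.
Qed.

Theorem theorem3p10 (R : realType) :
  exists (C : R -> R -> R -> R) (beta : R -> R -> R),
    (forall pm pp M : R, 0 < C pm pp M) /\
    (forall pm pp : R, 0 < beta pm pp) /\
    forall (N : nat) (D : set 'rV[R]_N) (p : 'rV[R]_N -> R)
           (f1 f2 : ('rV[R]_N -> R) -> R),
      (0 < N)%N -> open D -> bounded_set D ->
      log_exponent D p -> 1 < p_minus D p ->
      W1p0_dual D p f1 -> W1p0_dual D p f2 ->
      forall Omega : set 'rV[R]_N, open Omega -> Omega `<=` D ->
      forall u1 u2 : 'rV[R]_N -> R,
        weak_solution Omega p f1 u1 -> weak_solution Omega p f2 u2 ->
        (modular D p (fun x => enorm (grad D (extend0 Omega u1) x
                                      - grad D (extend0 Omega u2) x))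
         <= (C (p_minus D p) (p_plus D p)
               (Num.max (dual_norm D p f1) (dual_norm D p f2))
             * (dual_norm D p (f1 \- f2)
                + dual_norm D p (f1 \- f2)
                  `^ beta (p_minus D p) (p_plus D p)))%:E)%E.
Proof.
pose k (pm M : R) := gradient_bound pm M.
pose A (pm pp M : R) := 2 `^ pp * (2 / Num.min 1 (pm - 1)) * (4 * k pm M).
pose B (pm M : R) := M * k pm M + M * k pm M.
(* A and B are nonnegative for the arguments that occur; the absolute values
   make C positive for all the others. *)
exists (fun pm pp M => `|A pm pp M| + `|B pm M| + 1), (fun _ _ => 2^-1).
split; first by move=> pm pp M; rewrite ltr_wpDl// addr_ge0.
split; first by move=> _ _; rewrite invr_gt0.
move=> N D p f1 f2 N0 Do Db [pD _] pm1 f1D f2D U Uo UD u1 u2 us1 us2.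
have [mp p1 [Mp pMp]] := pD.
set pm := p_minus D p in pm1 *; set pp := p_plus D p.
set M := Num.max (dual_norm D p f1) (dual_norm D p f2).
have pmpp x : D x -> pm <= p x <= pp.
  move=> Dx; apply/andP; split.
    by apply: ge_inf; [exists 1 => _ [y Dy <-]; exact: p1|exists x].
  by apply: ub_le_sup; [exists Mp => _ [y Dy <-]; exact: pMp|exists x].
have [[u10 _] [u20 _]] := (us1, us2); have [[u1W _] [u2W _]] := (u10, u20).
have pU := variable_exponent_sub N0 Do pD UD.
have Ub := bounded_set_sub Db UD.
have uG1 := W1p_sobolev N0 Uo Ub pU u1W; have uG2 := W1p_sobolev N0 Uo Ub pU u2W.
have w1 := W1p0_extend0 N0 Do Db pD Uo UD u10.
have d0 := dual_norm_ge0 N0 Do Db pD (W1p0_dualB f1D f2D) w1.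
have M0 : 0 <= M by rewrite le_max (dual_norm_ge0 N0 Do Db pD f1D w1).
have m0 : 0 < Num.min 1 (pm - 1) by rewrite lt_min ltr01 subr_gt0.
have k0 : 0 <= k pm M by rewrite /k /gradient_bound addr_ge0// powR_ge0.
have A0 : 0 <= A pm pp M.
  by rewrite /A !mulr_ge0 ?powR_ge0 ?invr_ge0 ?(ltW m0).
have B0 : 0 <= B pm M by rewrite /B addr_ge0// mulr_ge0.
rewrite (ger0_norm A0) (ger0_norm B0).
have [[e1 _ _] [e2 _ _]] := (sobolev_extend0 N0 Do Db pD Uo UD u10 uG1,
                             sobolev_extend0 N0 Do Db pD Uo UD u20 uG2).
have g1 : weak_gradient D (extend0 U u1) (grad D (extend0 U u1)).
  by apply: weak_gradient_grad; exists (extend0_field U (grad U u1)).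
have g2 : weak_gradient D (extend0 U u2) (grad D (extend0 U u2)).
  by apply: weak_gradient_grad; exists (extend0_field U (grad U u2)).
pose G x := grad U u1 x - grad U u2 x.
have vG : sobolev U p _ G := sobolevB N0 Uo pU uG1 uG2.
have -> : modular D p (fun x => enorm (grad D (extend0 U u1) x
    - grad D (extend0 U u2) x)) = modular U p (fun x => enorm (G x)).
  rewrite -(modular_extend0 pD UD) -enorm_extend0_field.
  apply: (modular_ae (open_rV_measurable N0 Do) mp).
  - apply: measurable_enorm => i.
    have m1 := weak_gradient_measurable g1 i; have m2 := weak_gradient_measurable g2 i.
    by under eq_fun do rewrite !mxE; exact: measurable_funB.
  - rewrite enorm_extend0_field.
    have [_ _ [mG _]] := vG.
    exact: (measurable_extend0 N0 Do Uo UD).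
  - have h1 := grad_ae N0 Do e1; have h2 := grad_ae N0 Do e2.
    apply: filterS2 h1 h2 => x h1 h2 Dx; rewrite h1// h2//.
    congr (`|enorm _|); rewrite /extend0_field /G /patch.
    by case: ifP => _; rewrite ?subrr.
have fm : modular U p (fun x => enorm (G x)) \is a fin_num.
  by have [_ _ [_ fG]] := vG; rewrite ge0_fin_numE ?modular_ge0.
rewrite -(fineK fm) lee_fin; apply: optimize_scale => // s s01.
rewrite -lee_fin (fineK fm).
have pmpU x : U x -> pm <= p x <= pp by move=> /UD; exact: pmpp.
have f1M : dual_norm D p f1 <= M by rewrite le_max lexx.
have f2M : dual_norm D p f2 <= M by rewrite le_max lexx orbT.
apply: (le_trans (stability_estimate N0 Do Db pD Uo UD f1D f2D us1 us2 pm1 pmpU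
  f1M f2M M0 s01)).
rewrite lee_fin le_eqVlt; apply/orP; left; apply/eqP; rewrite /A /B /k.
move: (dual_norm D p (f1 \- f2)) (gradient_bound pm M) (2 / _) (2 `^ pp) (s^-1).
by move=> x1 x2 x3 x4 x5; ring.
Qed.
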